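(* Let $A$ be an $n$-CNakayama algebra and let $D$ be its $n$-periodic Dyck path. Suppose that $D\in\mathcal{D}^P_n\cup\mathcal{D}^H_n$. Then for every $i$: (1) $S_i$ is $1$-regular if and only if $\mathrm{LK}(D)$ has a $1$-cut at position $i$; (2) $S_i$ is $2$-regular if and only if $\mathrm{LK}(D)$ has a $2$-hill at position $i$.
   Context: Fix a field $\mathbb{F}$. An $n$-CNakayama algebra is $A=\mathbb{F}Q/I$ with $Q$ the cyclic quiver $0\to\cdots\to n-1\to0$ and $I$ admissible ($J^m\subseteq I\subseteq J^2$, $m\ge2$, $J$ the arrow ideal). Modules are right modules; $S_i$ is the simple at vertex $i$ (indices mod $n$); Kupisch series $c_i=\dim_{\mathbb{F}} e_iA$, extended $n$-periodically. A simple module $S$ is $k$-regular if $\operatorname{pd}(S)=k$, $\operatorname{Ext}^i_A(S,A)=0$ for $0\le i<k$ and $\dim_{\mathbb{F}}\operatorname{Ext}^k_A(S,A)=1$. Lattice paths use horizontal steps $(x,y)\to(x,y+1)$ and vertical steps $(x,y)\to(x+1,y)$. An $n$-periodic Dyck path is a bi-infinite lattice path invariant under translation by $(n,n)$ whose unique vertical step from $x=k$ to $x=k+1$ has $y$-coordinate $h_k\ge k+1$; its area sequence is $c_k=h_k-k+1$. The $n$-periodic Dyck path of $A$ is the one whose area sequence is the (periodically extended) Kupisch series of $A$. Valley at $(x,y)$: vertical step ending at $(x,y)$ immediately followed by a horizontal step. Rectangle at $(i+1,j)$: valley at $(i+1,j)$ whose next valley has $x$-coordinate $>j+1$. Return at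 position $p$: vertical step ending at $(p,p)$. Double rise with midpoint $(x,y)$: consecutive horizontal steps $(x,y-1)\to(x,y)\to(x,y+1)$; double fall with midpoint $(x,y)$: consecutive vertical steps $(x-1,y)\to(x,y)\to(x+1,y)$. $\mathcal{D}^P_n$: $n$-periodic Dyck paths with non-constant area sequence of minimal entry $2$. $\mathcal{D}^H_n$: $n$-periodic Dyck paths having a rectangle. For $D\in\mathcal{D}^P_n$: choose a return position $p$; enumerate increasingly the $y$-coordinates of double-rise midpoints as $(r_t)_{t\in\mathbb{Z}}$ with $r_1$ the smallest exceeding $p$, and the $x$-coordinates of double-fall midpoints as $(f_t)_{t\in\mathbb{Z}}$ with $f_1$ the smallest exceeding $p$; $\mathrm{LK}^P(D)$ is the $(n,n)$-periodic lattice path whose valleys are exactly $(r_t,f_t)$, $t\in\mathbb{Z}$. For $D\in\mathcal{D}^H_n$: choose $j$ such that $D$ has a rectangle with $y$-coordinate $j$, enumerate as before but with $r_1=f_1=j+1$; this defines $\mathrm{LK}^H(D)$ likewise. These do not depend on the choices, and $\mathrm{LK}^P=\mathrm{LK}^H$ on $\mathcal{D}^P_n\cap\mathcal{D}^H_n$. Set $\mathrm{LK}(D)=\mathrm{LK}^P(D)$ if $D\in\mathcal{D}^P_n$ and $\mathrm{LK}(D)=\mathrm{LK}^H(D)$ if $D\in\mathcal{D}^H_n$. A $1$-cut at position $i$: the path contains a horizontal step $(i,y)\to(i,y+1)$ and a vertical step $(x,i+1)\to(x+1,i+1)$. A $2$-hill at position $i$: the path contains the steps $(i,i)\to(i,i+1)\to(i,i+2)\to(i+1,i+2)\to(i+2,i+2)$.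 *)

(* Defs.v *)
From HB Require Import structures.
From mathcomp Require Import all_boot all_order all_algebra all_field.

Set Implicit Arguments.
Unset Strict Implicit.
Unset Printing Implicit Defensive.

Import Order.TTheory GRing.Theory Num.Theory.
Local Open Scope ring_scope.

(* The cyclic quiver with vertices 'I_n.+1 and one arrow i -> ordS i for each
   vertex i has exactly one path of each length l from each vertex i.  An
   element f of its path algebra is stored as the family of polynomials whose
   coefficient (f i)`_l is the coefficient in f of that path. *)
Definition path_alg (F : fieldType) (n : nat) : Type :=
  {ffun 'I_n.+1 -> {poly F}}.

Definition path_end (n l : nat) (i : 'I_n.+1) : 'I_n.+1 := iter l (@ordS n.+1) i.

Section PathAlgebra.
Variables (F : fieldType) (n : nat).
Notation FQ := (path_alg F n).

HB.instance Definition _ := GRing.Lmodule.copy FQ {ffun 'I_n.+1 -> {poly F}}.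

Definition qpath (i : 'I_n.+1) (l : nat) : FQ :=
  [ffun j => if j == i then 'X^l else 0].
Definition path_one : FQ := [ffun=> 1].

(* Paths are composed from left to right: see qpathM. *)
Definition path_mul (f g : FQ) : FQ :=
  [ffun i => \sum_(l < size (f i)) (f i)`_l *: ('X^l * g (path_end l i))].

Lemma path_endD l m (i : 'I_n.+1) :
  path_end m (path_end l i) = path_end (l + m) i.
Proof. by rewrite /path_end addnC iterD. Qed.

Lemma coef_path_mul (f g : FQ) i m :
  (path_mul f g i)`_m
    = \sum_(l < m.+1) (f i)`_l * (g (path_end l i))`_(m - l).
Proof.
rewrite ffunE coef_sum.
pose G l := (f i)`_l * (if (m < l)%N then 0 else (g (path_end l i))`_(m - l)).
transitivity (\sum_(l < size (f i)) G l).
  by apply: eq_bigr => l _; rewrite coefZ coefXnM.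
pose N := maxn (size (f i)) m.+1.
rewrite (big_ord_widen N G) ?leq_maxl // big_mkcond /=.
transitivity (\sum_(l < N) G l).
  apply: eq_bigr => l _; case: ltnP => // le_fl.
  by rewrite /G nth_default ?mul0r.
rewrite [RHS](eq_bigr (fun l : 'I_m.+1 => G l)); last first.
  by move=> l _; rewrite /G ltnNge -ltnS ltn_ord.
rewrite [RHS](big_ord_widen N G) ?leq_maxr // [RHS]big_mkcond /=.
by apply: eq_bigr => l _; case: ltnP => // lt_ml; rewrite /G lt_ml mulr0.
Qed.

Lemma path_mulA : associative path_mul.
Proof.
move=> f g h; apply/ffunP=> i; apply/polyP=> m; rewrite !coef_path_mul.
pose T k j := (f i)`_k * ((g (path_end k i))`_(j - k)
  * (h (path_end j i))`_(m - j)).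
transitivity (\sum_(k < m.+1) \sum_(j < m.+1 | (k <= j)%N) T k j).
  apply: eq_bigr => k _; rewrite coef_path_mul big_distrr /=.
  have lt_km : (k < m.+1)%N := ltn_ord k.
  rewrite -(big_mkord (fun j => (k <= j)%N) (T k)).
  have -> : \sum_(0 <= j < m.+1 | (k <= j)%N) T k j = \sum_(k <= j < m.+1) T k j.
    rewrite (big_cat_nat (n := k)) ?leq0n ?(ltnW lt_km) //=.
    rewrite big_nat_cond big_pred0 ?add0r => [|j]; last first.
      by rewrite leq0n /= ltnNge; case: (k <= j)%N.
    rewrite big_nat_cond [RHS]big_nat_cond; apply: eq_bigl => j.
    by case: (leqP k j); rewrite ?andbF ?andbT.
  rewrite -[X in \sum_(X <= _ < _) _]add0n big_addn subSn // big_mkord.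
  apply: eq_bigr => j _; rewrite /T addnK path_endD [(j + k)%N]addnC.
  by rewrite subnDA.
rewrite (exchange_big_dep xpredT) //=; apply: eq_bigr => j _.
rewrite coef_path_mul big_distrl /=.
rewrite (big_ord_widen m.+1 (fun k => (f i)`_k * (g (path_end k i))`_(j - k) * (h (path_end j i))`_(m - j))) ?ltn_ord //.
by apply: eq_big => k; rewrite ?ltnS // => _; rewrite /T mulrA.
Qed.

Lemma path_mul1l : left_id path_one path_mul.
Proof.
move=> f; apply/ffunP=> i; apply/polyP=> m; rewrite coef_path_mul.
rewrite big_ord_recl big1 => [|l _]; last by rewrite ffunE coef1 mul0r.
by rewrite ffunE coef1 mul1r addr0 subn0.
Qed.

Lemma path_mul1r : right_id path_one path_mul.
Proof.
move=> f; apply/ffunP=> i; apply/polyP=> m; rewrite coef_path_mul.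
rewrite big_ord_recr big1 => [|l _] /=; last first.
  by rewrite ffunE coef1 subn_eq0 leqNgt ltn_ord mulr0.
by rewrite ffunE coef1 subnn mulr1 add0r.
Qed.

Lemma path_mulDl : left_distributive path_mul +%R.
Proof.
move=> f g h; apply/ffunP=> i; apply/polyP=> m.
rewrite [in RHS]ffunE coefD !coef_path_mul -big_split.
by apply: eq_bigr => l _; rewrite ffunE coefD mulrDl.
Qed.

Lemma path_mulDr : right_distributive path_mul +%R.
Proof.
move=> f g h; apply/ffunP=> i; apply/polyP=> m.
rewrite [in RHS]ffunE coefD !coef_path_mul -big_split.
by apply: eq_bigr => l _; rewrite ffunE coefD mulrDr.
Qed.

Lemma path_one_neq0 : path_one != 0.
Proof.
apply/eqP=> /ffunP/(_ ord0); rewrite !ffunE => /eqP.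
by rewrite oner_eq0.
Qed.

HB.instance Definition _ := GRing.Zmodule_isNzRing.Build FQ
  path_mulA path_mul1l path_mul1r path_mulDl path_mulDr path_one_neq0.

Lemma path_scaleAl (c : F) (f g : FQ) : c *: (f * g) = (c *: f) * g.
Proof.
apply/ffunP=> i; apply/polyP=> m.
rewrite [in LHS]ffunE coefZ !coef_path_mul big_distrr /=.
by apply: eq_bigr => l _; rewrite ffunE coefZ mulrA.
Qed.

Lemma path_scaleAr (c : F) (f g : FQ) : c *: (f * g) = f * (c *: g).
Proof.
apply/ffunP=> i; apply/polyP=> m.
rewrite [in LHS]ffunE coefZ !coef_path_mul big_distrr /=.
by apply: eq_bigr => l _; rewrite ffunE coefZ mulrCA.
Qed.

HB.instance Definition _ := GRing.Lmodule_isLalgebra.Build F FQ path_scaleAl.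
HB.instance Definition _ := GRing.Lalgebra_isAlgebra.Build F FQ path_scaleAr.

Lemma qpathM i l j m :
  qpath i l * qpath j m = if path_end l i == j then qpath i (l + m) else 0.
Proof.
apply/ffunP=> k; rewrite [LHS]ffunE ffunE; case: (eqVneq k i) => [->|ki].
  rewrite size_polyXn big_ord_recr big1 /= => [|t _]; last first.
    by rewrite coefXn ltn_eqF ?scale0r.
  rewrite coefXn eqxx scale1r add0r ffunE.
  by case: ifP; rewrite !ffunE ?eqxx ?mulr0 // exprD.
by rewrite size_poly0 big_ord0; case: ifP; rewrite !ffunE ?(negPf ki).
Qed.

Definition vertex (i : 'I_n.+1) : FQ := qpath i 0.
Definition arrow (i : 'I_n.+1) : FQ := qpath i 1.

Lemma sum_vertex : \sum_i vertex i = 1.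
Proof.
apply/ffunP=> k; rewrite sum_ffunE (bigD1 k) //= big1 => [|i ik].
  by rewrite !ffunE eqxx addr0.
by rewrite ffunE eq_sym (negPf ik).
Qed.

End PathAlgebra.

Section Ideals.
Variable R : pzRingType.

Definition two_sided_ideal (I : R -> Prop) : Prop :=
  [/\ I 0, forall x y, I x -> I y -> I (x + y)
    & forall a x b, I x -> I (a * x * b)].

Definition ideal_gen (X : R -> Prop) (x : R) : Prop :=
  forall I, two_sided_ideal I -> (forall y, X y -> I y) -> I x.

Definition ideal_mul (I J : R -> Prop) : R -> Prop :=
  ideal_gen (fun z => exists x y, [/\ I x, J y & z = x * y]).

Fixpoint ideal_exp (I : R -> Prop) (m : nat) : R -> Prop :=
  if m is m'.+1 then ideal_mul I (ideal_exp I m') else fun=> True.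

End Ideals.

Definition arrow_ideal (F : fieldType) (n : nat) : path_alg F n -> Prop :=
  ideal_gen (fun x => exists i, x = arrow F i).

Definition admissible (F : fieldType) (n : nat) (I : path_alg F n -> Prop) :=
  two_sided_ideal I /\
  exists m, [/\ (2 <= m)%N,
    forall x, ideal_exp (@arrow_ideal F n) m x -> I x
  & forall x, I x -> ideal_exp (@arrow_ideal F n) 2 x].

Section Homological.
Variable R : pzRingType.

Definition surjective (T U : Type) (g : T -> U) : Prop :=
  forall y, exists x, g x = y.

Definition projective (P : lmodType R) : Prop :=
  forall (M N : lmodType R) (g : {linear M -> N}) (f : {linear P -> N}),
  surjective g -> exists h : {linear P -> M}, forall x, g (h x) = f x.

Record proj_resolution (M : lmodType R) := ProjResolution {
  pr_mod :> nat -> lmodType R;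
  pr_diff : forall k, {linear pr_mod k.+1 -> pr_mod k};
  pr_aug : {linear pr_mod 0 -> M};
  pr_proj : forall k, projective (pr_mod k);
  pr_aug_surj : surjective pr_aug;
  pr_exact0 : forall x, pr_aug x = 0 <-> exists y, pr_diff 0 y = x;
  pr_exactS : forall k x, pr_diff k x = 0 <-> exists y, pr_diff k.+1 y = x
}.

Definition pd_le (M : lmodType R) (k : nat) : Prop :=
  exists P : proj_resolution M, forall j, (k < j)%N -> forall x : P j, x = 0.

Definition has_pd (M : lmodType R) (k : nat) : Prop :=
  pd_le M k /\ forall j, (j < k)%N -> ~ pd_le M j.

Definition simple_module (M : lmodType R) : Prop :=
  (exists x : M, x != 0) /\
  forall U : M -> Prop, U 0 -> (forall a x y, U x -> U y -> U (a *: x + y)) ->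
  (forall x, U x -> x = 0) \/ (forall x, U x).

Section Cochains.
Variables (M N : lmodType R) (P : proj_resolution M).

Definition cocycle (k : nat) (f : P k -> N) : Prop :=
  forall x, f (pr_diff P k x) = 0.

Definition coboundary (k : nat) : (P k -> N) -> Prop :=
  match k with
  | 0 => fun f => forall x, f x = 0
  | j.+1 => fun f =>
      exists g : {linear P j -> N}, forall x, f x = g (pr_diff P j x)
  end.

End Cochains.
End Homological.

(* Right A-modules are left modules over the converse ring A^c, and (A^c)^o is
   A as a right module over itself. *)
Notation rmodType A := (lmodType A^c).

Section Ext.
Variables (F : fieldType) (A : algType F).

Definition fscale (M : rmodType A) (c : F) (x : M) : M := (c%:A : A^c) *: x.

(* dim_F Ext^k_A(M, N) = d: for a projective resolution P of M (the choice does
   not matter), the classes of some cocycles z_0, ..., z_(d-1) form an F-basis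
   of the k-th cohomology space of Hom_A(P, N). *)
Definition ext_dim (M N : rmodType A) (k d : nat) : Prop :=
  exists (P : proj_resolution M) (z : 'I_d -> {linear P k -> N}),
  [/\ forall i, cocycle (z i),
      forall f : {linear P k -> N}, cocycle f -> exists c : 'I_d -> F,
        coboundary (fun x => f x - \sum_i fscale (c i) (z i x))
    & forall c : 'I_d -> F,
        coboundary (fun x => \sum_i fscale (c i) (z i x)) ->
        forall i, c i = 0].

Definition k_regular (k : nat) (S : rmodType A) : Prop :=
  [/\ simple_module S, has_pd S k,
      forall i, (i < k)%N -> ext_dim S (A^c)^o i 0
    & ext_dim S (A^c)^o k 1].

End Ext.

Definition vertex_of (n : nat) (k : int) : 'I_n.+1 :=
  inord `|(k %% n.+1%:Z)%Z|%N.

Section CNakayama.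
Variables (F : fieldType) (n : nat).

Record CNakayama := CNakayamaAlgebra {
  cn_alg :> falgType F;
  cn_ideal : path_alg F n -> Prop;
  cn_adm : admissible cn_ideal;
  cn_proj : {lrmorphism path_alg F n -> cn_alg};
  cn_surj : surjective cn_proj;
  cn_ker : forall x, cn_proj x = 0 <-> cn_ideal x
}.

Variable A : CNakayama.

Definition idem (k : int) : A := cn_proj A (vertex F (vertex_of n k)).

Definition kupisch (k : int) : nat := \dim (limg (amull (idem k))).

Definition simple_at (k : int) (S : rmodType A) : Prop :=
  simple_module S /\ exists x : S, (idem k : A^c) *: x != 0.

End CNakayama.

Record lattice_path := LatticePath {
  lp_pt :> int -> int * int;
  lp_step : forall t, lp_pt (t + 1) = ((lp_pt t).1, (lp_pt t).2 + 1) \/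
                      lp_pt (t + 1) = ((lp_pt t).1 + 1, (lp_pt t).2)
}.

Section LatticePaths.
Implicit Types (D L : lattice_path) (i j k x y p : int).

Definition contains L (s : seq (int * int)) : Prop :=
  exists t : int, forall m : nat, (m < size s)%N -> L (t + m%:Z) = nth (0, 0) s m.

Definition hstep L x y := contains L [:: (x, y); (x, y + 1)].
Definition vstep L x y := contains L [:: (x, y); (x + 1, y)].

Definition periodic (n : nat) L : Prop :=
  forall x y, contains L [:: (x, y)] <-> contains L [:: (x + n%:Z, y + n%:Z)].

Definition dyck (n : nat) D : Prop :=
  periodic n D /\ forall k, exists2 h, vstep D k h & k + 1 <= h.

Definition area_sequence D (c : int -> int) : Prop :=
  forall k h, vstep D k h -> c k = h - k + 1.

Definition valley L x y := contains L [:: (x - 1, y); (x, y); (x, y + 1)].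

Definition next_valley L x x' : Prop :=
  [/\ x < x', exists y', valley L x' y'
    & forall x'' y'', valley L x'' y'' -> x < x'' -> x' <= x''].

Definition rectangle D x j : Prop :=
  valley D x j /\ exists2 x', next_valley D x x' & j + 1 < x'.

Definition return_at D p := vstep D (p - 1) p.

Definition double_rise D x y := contains D [:: (x, y - 1); (x, y); (x, y + 1)].
Definition double_fall D x y := contains D [:: (x - 1, y); (x, y); (x + 1, y)].

Definition DP (n : nat) D : Prop :=
  dyck n D /\ exists2 c, area_sequence D c &
  [/\ exists k l, c k <> c l, exists k, c k = 2 & forall k, 2 <= c k].

Definition DH (n : nat) D : Prop :=
  dyck n D /\ exists x j, rectangle D x j.

Definition enumerates (X : int -> Prop) (u : int -> int) : Prop :=
  {homo u : s t / s < t} /\ forall y, X y <-> exists t, u t = y.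

Definition enum_rises D := enumerates (fun y => exists x, double_rise D x y).
Definition enum_falls D := enumerates (fun x => exists y, double_fall D x y).

Definition has_valleys (n : nat) L (r f : int -> int) : Prop :=
  periodic n L /\ forall x y, valley L x y <-> exists t, (x, y) = (r t, f t).

(* LKP n D L, LKH n D L and LK n D L say that L is the path LK^P(D), LK^H(D)
   and LK(D), respectively. *)
Definition LKP (n : nat) D L : Prop :=
  exists p r f, [/\ return_at D p, enum_rises D r /\ enum_falls D f,
    r 0 <= p < r 1, f 0 <= p < f 1 & has_valleys n L r f].

Definition LKH (n : nat) D L : Prop :=
  exists j r f, [/\ exists x, rectangle D x j, enum_rises D r /\ enum_falls D f,
    r 1 = j + 1, f 1 = j + 1 & has_valleys n L r f].

Definition LK (n : nat) D L : Prop :=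
  (DP n D /\ LKP n D L) \/ (DH n D /\ LKH n D L).

Definition one_cut L i : Prop :=
  (exists y, hstep L i y) /\ (exists x, vstep L x (i + 1)).

Definition two_hill L i : Prop :=
  contains L [:: (i, i); (i, i + 1); (i, i + 2); (i + 1, i + 2); (i + 2, i + 2)].

End LatticePaths.

Definition dyck_path_of (F : fieldType) (n : nat) (A : CNakayama F n)
    (D : lattice_path) : Prop :=
  dyck n.+1 D /\ area_sequence D (fun k => (kupisch A k)%:Z).

(* Main.v *)
Require Import Defs.
From HB Require Import structures.
From mathcomp Require Import all_boot all_order all_algebra all_field.
From mathcomp Require Import zify.
Import Order.TTheory GRing.Theory Num.Theory.
Local Open Scope ring_scope.

Set Implicit Arguments.
Unset Strict Implicit.
Unset Printing Implicit Defensive.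

(** Write H k = k + c_k - 1 for the ordinate of the vertical step of D from k to
    k + 1.  The module e_k A is uniserial with socle the simple module at H k, so
    Hom(S_i, A) = 0 iff i is not a value of H, i.e. iff i is the ordinate of a
    double rise; and pd S_i = 1 iff H i = H (i + 1), i.e. iff i + 1 is the abscissa
    of a double fall.  The minimal projective resolution of S_i has terms e_v A
    and differentials left multiplication by paths.  It shows that Ext^1(S_i, A)
    is automatically one-dimensional when pd S_i = 1, and that S_i is 2-regular
    iff i is not a value of H, H i = i + 1 and H (i + 1) = H (i + 2).

    On the side of LK(D), a 1-cut at i says that i is some r_s and i + 1 some f_t,
    while a 2-hill at i says that r_t = i, f_(t+1) = i + 2, f_t <= i and
    r_(t+1) >= i + 2 for some t.  To control the indices, let v(y) and w(x) count
    the levels up to y carrying a vertical step and the valleys up to abscissa x,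
    normalised by the enumerations r and f.  Then v(H x) - w(x) does not depend
    on x, and either choice of base point (a return or a rectangle) makes this
    constant equal to 1.  *)

(** * Submodules and comparison of projective resolutions *)

Section Submodules.
Variables (R : pzRingType) (M : lmodType R).

Record submod := Submod {
  submod_mem :> {pred M};
  submod_mem_closed : submod_closed submod_mem }.

Section SubmodType.
Variable U : submod.

HB.instance Definition _ :=
  GRing.isSubmodClosed.Build R M (submod_mem U) (submod_mem_closed U).

Record submod_type := SubmodType { submod_val : M; _ : submod_val \in submod_mem U }.
HB.instance Definition _ := [isSub for submod_val].
HB.instance Definition _ := [Choice of submod_type by <:].
HB.instance Definition _ := [SubChoice_isSubLmodule of submod_type by <:].

Section Corestriction.
Variables (N : lmodType R) (f : {linear N -> M}) (fU : forall x, f x \in submod_mem U).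

Definition corestr (x : N) : submod_type := SubmodType (fU x).
Fact corestr_is_linear : linear corestr.
Proof. by move=> a x y; apply: val_inj; rewrite /= !linearP. Qed.
HB.instance Definition _ :=
  GRing.isLinear.Build R N submod_type *:%R corestr corestr_is_linear.
End Corestriction.
End SubmodType.
End Submodules.

Section Comparison.
Variable R : pzRingType.
Implicit Types M N P : lmodType R.

Section Kernel.
Variables (M N : lmodType R) (d : {linear M -> N}).
Fact ker_closed : submod_closed [pred x | d x == 0].
Proof.
split=> [|a x y]; rewrite !inE ?linear0 // => /eqP dx /eqP dy.
by rewrite linearP dx dy scaler0 addr0.
Qed.
Definition kernel : submod M := Submod ker_closed.
End Kernel.

(** Exactness makes [d'] surjective onto the kernel of [d], where [f] takes its values, so
    projectivity applies to the two corestrictions. *)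
Lemma projective_lift P (B' B C : lmodType R) (d' : {linear B' -> B})
    (d : {linear B -> C}) (f : {linear P -> B}) :
  projective P -> (forall x, d x = 0 <-> exists y, d' y = x) ->
  (forall x, d (f x) = 0) -> exists h : {linear P -> B'}, forall x, d' (h x) = f x.
Proof.
move=> Pproj ex df.
have d'K y : d' y \in submod_mem (kernel d) by rewrite inE; apply/eqP/ex; exists y.
have fK x : f x \in submod_mem (kernel d) by rewrite inE; apply/eqP.
have [|h hE] := Pproj _ _ (corestr d'K) (corestr fK).
  move=> [x xK]; have /ex[y dy] : d x = 0 by apply/eqP; move: xK; rewrite inE.
  by exists y; apply: val_inj.
by exists h => x; have /(congr1 val) := hE x.
Qed.

Variables (M : lmodType R) (P Q : proj_resolution M).

Lemma pr_diff_diff (P' : proj_resolution M) k x : pr_diff P' k (pr_diff P' k.+1 x) = 0.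
Proof. by apply/pr_exactS; exists x. Qed.

Lemma pr_aug_diff (P' : proj_resolution M) x : pr_aug P' (pr_diff P' 0 x) = 0.
Proof. by apply/pr_exact0; exists x. Qed.

(* The components in degrees k and k + 1 of chain maps a, b between P and Q, and
   the part in degree k of a homotopy between a b and the identity. *)
Definition comparison k : Prop :=
  exists (a : {linear P k -> Q k}) (b : {linear Q k -> P k})
    (a' : {linear P k.+1 -> Q k.+1}) (b' : {linear Q k.+1 -> P k.+1})
    (s : {linear Q k -> Q k.+1}),
  [/\ forall x, pr_diff Q k (a' x) = a (pr_diff P k x),
      forall x, pr_diff P k (b' x) = b (pr_diff Q k x)
    & forall x, pr_diff Q k (a' (b' x) - x - s (pr_diff Q k x)) = 0].

Lemma comparison0 : comparison 0.
Proof.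
have [a aE] := pr_proj (pr_aug P) (@pr_aug_surj _ _ Q).
have [b bE] := pr_proj (pr_aug Q) (@pr_aug_surj _ _ P).
have [|a' a'E] := projective_lift (f := a \o pr_diff P 0) (@pr_proj _ _ P 1%N) (@pr_exact0 _ _ Q).
  by move=> x; rewrite /= aE pr_aug_diff.
have [|b' b'E] := projective_lift (f := b \o pr_diff Q 0) (@pr_proj _ _ Q 1%N) (@pr_exact0 _ _ P).
  by move=> x; rewrite /= bE pr_aug_diff.
have [|s sE] := projective_lift (f := (a \o b) \- idfun) (@pr_proj _ _ Q 0%N) (@pr_exact0 _ _ Q).
  by move=> x; rewrite /= linearB /= aE bE subrr.
exists a, b, a', b', s; split=> // x.
by rewrite !linearB /= a'E /= b'E sE /= subrr.
Qed.

Lemma comparisonS k : comparison k -> comparison k.+1.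
Proof.
move=> [a [b [a' [b' [s [aE bE sE]]]]]].
have [|a'' a''E] := projective_lift (f := a' \o pr_diff P k.+1) (@pr_proj _ _ P k.+2)
    (@pr_exactS _ _ Q k).
  by move=> x; rewrite /= aE pr_diff_diff linear0.
have [|b'' b''E] := projective_lift (f := b' \o pr_diff Q k.+1) (@pr_proj _ _ Q k.+2)
    (@pr_exactS _ _ P k).
  by move=> x; rewrite /= bE pr_diff_diff linear0.
(* The third clause in degree [k] says that [a' b' - 1 - s d] takes values in cycles; lifting it
   gives the next part of the homotopy. *)
have [|s' s'E] := projective_lift (f := ((a' \o b') \- idfun) \- (s \o pr_diff Q k))
    (@pr_proj _ _ Q k.+1) (@pr_exactS _ _ Q k).
  by move=> x; rewrite -[RHS](sE x).
exists a', b', a'', b'', s'; split=> // x.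
by rewrite !linearB /= a''E /= b''E s'E /= pr_diff_diff linear0 subr0 subrr.
Qed.

Lemma comparisonP k : comparison k.
Proof. by elim: k => [|k]; [apply: comparison0 | apply: comparisonS]. Qed.

End Comparison.

(** * Projective dimension and Ext read off from another resolution *)

Section Invariance.
Variable R : pzRingType.

(** If [P] vanishes in degree [k.+1], then [b'] is zero and the homotopy identity becomes
    [d = - d s d]. Hence [- d s] projects [Q k] onto the image of [d]. *)
Lemma pd_le_split (M : lmodType R) k (Q : proj_resolution M) : pd_le M k ->
  exists g : {linear Q k -> Q k}, (forall x, exists y, g x = pr_diff Q k y) /\
    forall y, g (pr_diff Q k y) = pr_diff Q k y.
Proof.
move=> [P P0]; have [a [b [a' [b' [s [aE bE sE]]]]]] := comparisonP P Q k.
exists (\- (pr_diff Q k \o s)); split=> x.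
  by exists (- s x); rewrite linearN.
have /eqP := sE x; rewrite (P0 _ (ltnSn k) (b' x)) linear0 sub0r -opprD linearN.
by rewrite oppr_eq0 linearD addr_eq0 => /eqP dE; rewrite {2}dE.
Qed.

End Invariance.

Section ExtInvariance.
Variables (F : fieldType) (A : algType F).

(** A cocycle in degree 0 factors through the augmentation, so it vanishes as soon as its pullback
    to the resolution provided by [ext_dim] does. *)
Lemma ext_dim00 (M N : rmodType A) (Q : proj_resolution M) (f : {linear Q 0%N -> N}) :
  ext_dim M N 0 0 -> cocycle f -> forall x, f x = 0.
Proof.
move=> [P [z [_ zspan _]]] fcoc x.
have [b bE] := pr_proj (pr_aug P) (@pr_aug_surj _ _ Q).
have [y yE] := @pr_aug_surj _ _ P (pr_aug Q x).
have [|c fb0] := zspan (f \o b).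
  move=> u /=; have /pr_exact0[w <-] : pr_aug Q (b (pr_diff P 0 u)) = 0.
    by rewrite bE; apply/pr_exact0; exists u.
  exact: fcoc.
have /pr_exact0[w wE] : pr_aug Q (b y - x) = 0 by rewrite linearB /= bE yE subrr.
have /eqP := fcoc w; rewrite wE linearB subr_eq0 => /eqP <-.
by have := fb0 y; rewrite big_ord0 subr0.
Qed.

(** The classes are pulled back along the chain map [b']. For a cocycle [f] the homotopy gives
    [f = f a' b' - f s d], whence the correction [f s] in the coboundary. *)
Lemma ext_dim_span (M N : rmodType A) (Q : proj_resolution M) k d :
  ext_dim M N k.+1 d -> exists z : 'I_d -> {linear Q k.+1 -> N},
  forall f : {linear Q k.+1 -> N}, cocycle f -> exists (c : 'I_d -> F),
    coboundary (fun x => f x - \sum_i fscale (c i) (z i x)).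
Proof.
move=> [P [z [_ zspan _]]].
have [a [b [a' [b' [s [aE bE sE]]]]]] := comparisonP P Q k.
exists (fun i => z i \o b') => f fcoc.
have [|c [g gE]] := zspan (f \o a').
  move=> u /=; have /pr_exactS[w <-] : pr_diff Q k (a' (pr_diff P k.+1 u)) = 0.
    by rewrite aE pr_diff_diff linear0.
  exact: fcoc.
exists c, ((g \o b) \- (f \o s)) => x /=.
have /pr_exactS[w wE] := sE x.
have /eqP := fcoc w; rewrite wE !linearB /= subr_eq0 subr_eq => /eqP fab.
by rewrite -bE -gE /= fab [_ + f x]addrC addrAC addrK.
Qed.

End ExtInvariance.

(** * Paths in a cyclic Nakayama algebra *)

Section PathCoefficients.
Variables (F : fieldType) (n : nat).
Notation FQ := (path_alg F n).
Implicit Types (f g : FQ) (i u v : 'I_n.+1).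

Lemma path_end_inj l : injective (@path_end n l).
Proof. by elim: l => [|l IHl] i j //= /ordS_inj/IHl. Qed.

Lemma path_coefD f g i m : ((f + g) i)`_m = (f i)`_m + (g i)`_m.
Proof. by rewrite ffunE coefD. Qed.

Lemma path_coefZ (c : F) f i m : ((c *: f) i)`_m = c * (f i)`_m.
Proof. by rewrite ffunE coefZ. Qed.

Lemma coef_qpath u l i m : (qpath F u l i)`_m = ((i == u) && (m == l))%:R.
Proof. by rewrite ffunE; case: eqP => _; rewrite ?coefXn ?coef0. Qed.

Lemma coef_qpathM u l f i m : ((qpath F u l * f : FQ) i)`_m =
  if (i == u) && (l <= m)%N then (f (path_end l u))`_(m - l) else 0.
Proof.
rewrite coef_path_mul; case: (eqVneq i u) => [->|iu] /=; last first.
  by rewrite big1 // => k _; rewrite coef_qpath (negPf iu) mul0r.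
case: leqP => [lm|ml]; last first.
  rewrite big1 // => k _; rewrite coef_qpath eqxx /= ltn_eqF ?mul0r //.
  exact: leq_trans (ltn_ord k) _.
have lm' : (l < m.+1)%N by [].
rewrite (bigD1 (Ordinal lm')) //= big1 => [|k kl].
  by rewrite coef_qpath !eqxx mul1r addr0.
by rewrite coef_qpath -[_ == l]/(k == Ordinal lm') (negPf kl) andbF mul0r.
Qed.

Lemma coefM_qpath v l f i m : ((f * qpath F v l : FQ) i)`_m =
  if (l <= m)%N && (path_end (m - l) i == v) then (f i)`_(m - l) else 0.
Proof.
rewrite coef_path_mul; case: leqP => [lm|ml] /=; last first.
  rewrite big1 // => k _; rewrite coef_qpath [_ == l]ltn_eqF ?andbF ?mulr0 //.
  exact: leq_ltn_trans (leq_subr _ _) _.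
have lm' : (m - l < m.+1)%N by rewrite ltnS leq_subr.
rewrite (bigD1 (Ordinal lm')) //= big1 ?addr0 => [|k kl].
  by rewrite coef_qpath subKn // eqxx andbT; case: eqP; rewrite ?mulr1 ?mulr0.
rewrite coef_qpath [_ == l](negPf _) ?andbF ?mulr0 //.
by apply: contra kl => /eqP kl; apply/eqP/val_inj => /=; have := ltn_ord k; lia.
Qed.

Lemma path_alg_sum f : f = \sum_i \sum_(l < size (f i)) (f i)`_l *: qpath F i l.
Proof.
apply/ffunP => k; rewrite sum_ffunE (bigD1 k) //= [X in _ + X]big1 ?addr0 => [|i ik].
  rewrite -{1}[f k]coefK poly_def sum_ffunE; apply: eq_bigr => l _.
  by rewrite !ffunE eqxx.
by rewrite sum_ffunE big1 // => l _; rewrite !ffunE eq_sym (negPf ik) scaler0.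
Qed.

(** In terms of coefficients, this is the [k]-th power of the arrow ideal. *)
Definition low_zero k f : Prop := forall i m, (m < k)%N -> (f i)`_m = 0.

Lemma low_zeroM k l f g : low_zero k f -> low_zero l g -> low_zero (k + l) (f * g).
Proof.
move=> fk gl i m mkl; rewrite coef_path_mul big1 // => j _.
case: (ltnP j k) => jk; first by rewrite fk // mul0r.
by rewrite gl ?mulr0 //; have := ltn_ord j; lia.
Qed.

Lemma low_zero_ideal k : two_sided_ideal (low_zero k).
Proof.
split=> [i m _|f g fk gk i m mk|a f b fk]; first by rewrite ffunE coef0.
  by rewrite ffunE coefD fk // gk // addr0.
have z0 g : low_zero 0 g by [].
have <- : (0 + k + 0 = k)%N by rewrite addn0.
by apply: low_zeroM (z0 b); apply: low_zeroM.
Qed.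

(** A member of a generated ideal lies in every ideal containing the generators, in particular in
    [low_zero k.+1]. *)
Lemma arrow_ideal_exp_low k f : ideal_exp (@arrow_ideal F n) k f -> low_zero k f.
Proof.
elim: k f => [|k IHk] f //= /(_ _ (low_zero_ideal k.+1)); apply=> _ [x [y [xJ yJ ->]]].
rewrite -add1n; apply: low_zeroM; last exact: IHk.
apply: xJ; first exact: low_zero_ideal.
by move=> _ [i ->] j [|//] _; rewrite coef_qpath andbF.
Qed.

Lemma qpath_arrow_ideal_exp k i : ideal_exp (@arrow_ideal F n) k (qpath F i k).
Proof.
elim: k i => [|k IHk] i //= I _; apply; exists (arrow F i), (qpath F (ordS i) k).
split=> //; last by rewrite qpathM /= eqxx.
by move=> J _; apply; exists i.
Qed.

End PathCoefficients.

Lemma vertex_ofS n (k : int) : vertex_of n (k + 1) = ordS (vertex_of n k).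
Proof.
apply: val_inj; rewrite /= /vertex_of !inordK; last 2 first.
- by have := modz_ge0 k (_ : n.+1%:Z != 0); have := @ltz_mod k n.+1%:Z; lia.
- by have := modz_ge0 (k + 1) (_ : n.+1%:Z != 0); have := @ltz_mod (k + 1) n.+1%:Z; lia.
rewrite -modzDml.
have := modz_ge0 k (_ : n.+1%:Z != 0); have := @ltz_mod k n.+1%:Z.
case: (k %% _)%Z => m; last by lia.
by rewrite -PoszD modz_nat addn1.
Qed.

Lemma vertex_ofD n (k : int) l : vertex_of n (k + l%:Z) = path_end l (vertex_of n k).
Proof.
elim: l => [|l IHl]; first by rewrite addr0.
rewrite -[RHS]/(ordS (path_end l _)) -IHl -vertex_ofS; congr vertex_of; lia.
Qed.

(** * Coefficients, radical filtration and annihilators in the quotient algebra *)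

Section NakayamaPaths.
Variables (F : fieldType) (n : nat) (A : CNakayama F n).
Notation FQ := (path_alg F n).
Implicit Types (f g : FQ) (i u v : 'I_n.+1) (x y : A).

Definition npath i l : A := cn_proj A (qpath F i l).

Lemma npathM i l j m :
  npath i l * npath j m = if path_end l i == j then npath i (l + m) else 0.
Proof. by rewrite -rmorphM qpathM; case: ifP => _; rewrite ?rmorph0. Qed.

Lemma npathMend i l m : npath i l * npath (path_end l i) m = npath i (l + m).
Proof. by rewrite npathM eqxx. Qed.

Lemma npath_vanish i : exists l, npath i l == 0.
Proof.
have [_ [m [_ mI _]]] := cn_adm A.
by exists m; apply/eqP/cn_ker/mI/qpath_arrow_ideal_exp.
Qed.

(** This is the Kupisch series, as [kupischE] shows, in a form read off directly from the vanishing
    of paths. *)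
Definition clen i := ex_minn (npath_vanish i).

Lemma npath_eq0 i l : (npath i l == 0) = (clen i <= l)%N.
Proof.
rewrite /clen; case: ex_minnP => c /eqP c0 cmin; apply/idP/idP => [/cmin//|cl].
by rewrite -(subnKC cl) -npathMend c0 mul0r.
Qed.

Lemma clen_ge2 i : (2 <= clen i)%N.
Proof.
rewrite ltnNge -npath_eq0; apply/eqP; rewrite cn_ker.
have [_ [m [_ _ I2]]] := cn_adm A => /I2/arrow_ideal_exp_low/(_ i 1 isT)/eqP.
by rewrite coef_qpath !eqxx oner_eq0.
Qed.

(** A path starting with an arrow vanishes once its remainder does; this is the classical inequality
    between consecutive Kupisch entries. *)
Lemma clen_ordS i : (clen i <= (clen (ordS i)).+1)%N.
Proof.
rewrite -npath_eq0 -add1n -npathMend (_ : npath (path_end 1 i) _ = 0) ?mulr0 //.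
by apply/eqP; rewrite npath_eq0.
Qed.

(** With its converse [cn_proj_eq0P], this shows that the ideal consists of combinations of
    vanishing paths. Equations in [A] can therefore be checked on the coefficients of length less
    than [clen i]. *)
Lemma cn_proj_eq0 f : (forall i l, (l < clen i)%N -> (f i)`_l = 0) -> cn_proj A f = 0.
Proof.
move=> f0; rewrite (path_alg_sum f) linear_sum big1 // => i _.
rewrite linear_sum big1 // => l _; rewrite linearZ /=.
case: (ltnP l (clen i)) => [/f0 -> | cl]; first by rewrite scale0r.
by move: cl; rewrite -npath_eq0 => /eqP; rewrite /npath => ->; rewrite scaler0.
Qed.

Lemma cn_proj_eq f g : (forall i l, (l < clen i)%N -> (f i)`_l = (g i)`_l) ->
  cn_proj A f = cn_proj A g.
Proof.
move=> fg; apply/eqP; rewrite -subr_eq0 -linearB; apply/eqP/cn_proj_eq0 => i l lc.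
by rewrite !ffunE coefB fg // subrr.
Qed.

(* Multiplying by a path that moves the lowest nonzero coefficient to length
   clen i - 1 kills all the other terms. *)
Lemma cn_proj_eq0P f : cn_proj A f = 0 ->
  forall i l, (l < clen i)%N -> (f i)`_l = 0.
Proof.
move=> f0 i l; have [k] := ubnP l; elim: k l => // k IHk l lk lc.
have {}IHk m : (m < l)%N -> (f i)`_m = 0 by move=> ml; apply: IHk; lia.
pose v := path_end l i; pose t := (clen i - l.+1)%N.
have /eqP : cn_proj A (qpath F i 0 * f * qpath F v t) = cn_proj A ((f i)`_l *: qpath F i (clen i).-1).
  apply: cn_proj_eq => j m mc; rewrite coefM_qpath coef_qpathM path_coefZ coef_qpath.
  case: (eqVneq j i) mc => [->|ji] mc /=; last by rewrite mulr0 if_same.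
  rewrite subn0; case: (eqVneq m (clen i).-1) => [->|mc'] /=.
    have -> : ((clen i).-1 - t = l)%N by rewrite /t; lia.
    have -> : (t <= (clen i).-1)%N by rewrite /t; lia.
    by rewrite eqxx mulr1.
  by rewrite mulr0; case: ifP => // /andP[tm _]; apply: IHk; rewrite /t in tm *; lia.
rewrite !rmorphM /= f0 mulr0 mul0r eq_sym linearZ scaler_eq0 => /orP[/eqP //|].
by rewrite [_ == 0]npath_eq0; have := clen_ge2 i; lia.
Qed.

Lemma cn_proj_eqP f g : cn_proj A f = cn_proj A g ->
  forall i l, (l < clen i)%N -> (f i)`_l = (g i)`_l.
Proof.
move=> /eqP; rewrite -subr_eq0 -linearB => /eqP/cn_proj_eq0P fg i l /fg/eqP.
by rewrite !ffunE coefB subr_eq0 => /eqP.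
Qed.

(** The nonzero paths starting at the vertex of [k] form a basis of [e_k A]. *)
Lemma kupischE (k : int) : kupisch A k = clen (vertex_of n k).
Proof.
rewrite /kupisch /idem; set i := vertex_of n k; rewrite -[vertex F i]/(qpath F i 0) -/(npath i 0).
pose X := [tuple npath i l | l < clen i].
have freeX : free X.
  apply/freeP => c; under eq_bigr => l _ do rewrite -tnth_nth tnth_mktuple /npath -linearZ.
  rewrite -linear_sum => /cn_proj_eq0P/(_ i) c0 l.
  have := c0 l (ltn_ord l); rewrite sum_ffunE coef_sum (bigD1 l) //= big1 => [|m ml].
    by rewrite path_coefZ coef_qpath !eqxx mulr1 addr0.
  by rewrite path_coefZ coef_qpath eqxx eq_sym -[_ == _ :> nat]/(m == l) (negPf ml) mulr0.
suff -> : limg (amull (npath i 0)) = <<X>>%VS by rewrite (eqP freeX) size_tuple.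
apply/eqP; rewrite eqEsubv; apply/andP; split; apply/subvP => x.
  move=> /memv_imgP[y _ ->]; have [f <-] := cn_surj y; rewrite lfunE /=.
  rewrite /npath -rmorphM /=.
  have -> : cn_proj A (qpath F i 0 * f) = \sum_(l < clen i) (f i)`_l *: npath i l.
    under eq_bigr => l _ do rewrite /npath -linearZ.
    rewrite -linear_sum; apply: cn_proj_eq => j m mc; rewrite coef_qpathM sum_ffunE coef_sum.
    case: (eqVneq j i) mc => [->|ji] mc /=; last first.
      by rewrite big1 // => l _; rewrite path_coefZ coef_qpath (negPf ji) mulr0.
    rewrite subn0 (bigD1 (Ordinal mc)) //= big1 => [|l lm].
      by rewrite path_coefZ coef_qpath !eqxx mulr1 addr0.
    by rewrite path_coefZ coef_qpath eqxx eq_sym -[_ == _ :> nat]/(l == Ordinal mc) (negPf lm) mulr0.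
  apply: rpred_sum => l _; apply/rpredZ/memv_span.
  by rewrite -(tnth_mktuple (fun l : 'I__ => npath i l)) mem_tnth.
move: x; apply/subvP/span_subvP => x /tnthP[l ->]; rewrite tnth_mktuple.
by apply/memv_imgP; exists (npath i l); rewrite ?memvf // lfunE /= npathMend.
Qed.

(** The image of the [k]-th power of the arrow ideal, that is, the [k]-th power of the radical of
    [A]. *)
Definition low k x : Prop := exists2 f, cn_proj A f = x & low_zero k f.

Lemma lowM k l x y : low k x -> low l y -> low (k + l) (x * y).
Proof.
move=> [f <- fk] [g <- gl]; exists (f * g); first by rewrite rmorphM.
exact: low_zeroM.
Qed.

Lemma low_npath u l : low l (npath u l).
Proof.
exists (qpath F u l) => // i m ml; rewrite coef_qpath.
by case: eqP => //= _; rewrite ltn_eqF.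
Qed.

Lemma low0 x : low 0 x.
Proof. by have [f <-] := cn_surj x; exists f. Qed.

Lemma low1_nilpotent x : low 1 x -> exists k, x ^+ k = 0.
Proof.
move=> x1; exists (\max_i clen i).
have [f <- fk] : low (\max_i clen i) (x ^+ (\max_i clen i)).
  move: (\max_i clen i) => k; elim: k => [|k IHk]; first exact: low0.
  by rewrite exprS -add1n; apply: lowM.
apply: cn_proj_eq0 => i l lc; apply: fk; apply: leq_trans lc _.
exact: leq_bigmax.
Qed.

(** The factor [npath u l * x] lies in the radical, so it is nilpotent, and iterating the equation
    kills [y]. This later excludes splittings in the minimal resolution. *)
Lemma npath_unfixed u l x y : (0 < l)%N -> npath u l * x * y = y -> y = 0.
Proof.
move=> l0 xy; have [|k xk] := @low1_nilpotent (npath u l * x).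
  have : low (l + 0) (npath u l * x) by apply: lowM; [apply: low_npath | apply: low0].
  move=> [f <- fl]; exists f => // i [|//] _; apply: fl; lia.
suff: (npath u l * x) ^+ k * y = y by rewrite xk mul0r.
by elim: k {xk} => [|k IHk]; rewrite ?mul1r // exprSr -mulrA xy.
Qed.

(** An element annihilated by the path has no term short enough to survive the product, so all its
    terms begin with the path of length [clen A u - l]. The witness [g] strips that initial path
    from [f v]. *)
Lemma npath_kernel u l x : (l <= clen u)%N -> npath (path_end l u) 0 * x = x ->
  npath u l * x = 0 ->
  exists2 y, npath (path_end (clen u) u) 0 * y = y & npath (path_end l u) (clen u - l) * y = x.
Proof.
have [f <-] := cn_surj x; rewrite /npath -!rmorphM => lc /cn_proj_eqP fE /cn_proj_eq0P f0.
set v := path_end l u in fE f0 *; set w := path_end (clen u) u.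
have vw : path_end (clen u - l) v = w by rewrite path_endD subnKC.
pose g : FQ := [ffun i => if i == w then drop_poly (clen u - l) (f v) else 0].
exists (cn_proj A g); rewrite -rmorphM; apply: cn_proj_eq => i m mc.
  by rewrite coef_qpathM !ffunE eqxx subn0; case: eqP; rewrite ?coef0.
rewrite -(fE i m mc) !coef_qpathM vw ffunE eqxx coef_drop_poly.
case: (eqVneq i v) => [iv|//] /=; rewrite subn0.
case: leqP => [cm|mc']; first by rewrite subnK.
have /(f0 u) : (m + l < clen u)%N by lia.
by rewrite coef_qpathM eqxx leq_addl addnK /= => ->.
Qed.

(* [npath v 1] annihilates exactly the socles of the projectives [npath i 0 * A]
   that are isomorphic to the simple module at v. *)
Lemma npath_left_annihilator v x : (forall i, path_end (clen i).-1 i != v) ->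
  x * npath v 0 = x -> x * npath v 1 = 0 -> x = 0.
Proof.
have [f <-] := cn_surj x; rewrite /npath -!rmorphM => vP /cn_proj_eqP fE /cn_proj_eq0P f0.
apply: cn_proj_eq0 => i m mc; rewrite -fE // coefM_qpath /= subn0.
case: eqP => // mv; have [m1c|cm1] := ltnP m.+1 (clen i).
  by have := f0 i _ m1c; rewrite coefM_qpath subn1 /= mv eqxx.
by have /eqP[] := vP i; rewrite -mv; congr path_end; lia.
Qed.

(** Every path of positive length ending at [ordS v] ends with the arrow at [v]. So [A e_(v+1)]
    modulo the left ideal of this arrow is spanned by the idempotent, which is what the Ext
    computations use. *)
Lemma npath_right_ideal v x : x * npath (ordS v) 0 = x ->
  exists (c : F) y, x = c *: npath (ordS v) 0 + y * npath v 1.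
Proof.
have [f <-] := cn_surj x; rewrite /npath -!rmorphM => /cn_proj_eqP fE.
exists (f (ordS v))`_0, (cn_proj A [ffun i => drop_poly 1 (f i)]).
rewrite -rmorphM -linearZ -linearD; apply: cn_proj_eq => i m mc.
rewrite -(fE i m mc) path_coefD path_coefZ coef_qpath !coefM_qpath ffunE.
rewrite coef_drop_poly.
case: m mc => [|m] mc /=.
  by rewrite addr0 eqxx andbT; case: eqP => [->|]; rewrite ?mulr1 ?mulr0.
rewrite andbF mulr0 add0r !subn0 subn1 addn1 /=.
by rewrite (inj_eq (@ordS_inj _)).
Qed.

Lemma npath_left_ideal v x : npath v 0 * x = x ->
  exists (c : F) y, npath (ordS v) 0 * y = y /\ x = c *: npath v 0 + npath v 1 * y.
Proof.
have [f <-] := cn_surj x; rewrite /npath -!rmorphM => /cn_proj_eqP fE.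
pose g : FQ := [ffun i => if i == ordS v then drop_poly 1 (f v) else 0].
exists (f v)`_0, (cn_proj A g); split.
  rewrite -rmorphM; apply: cn_proj_eq => i m mc; rewrite coef_qpathM !ffunE eqxx subn0.
  by case: eqP; rewrite ?coef0.
rewrite -rmorphM -linearZ -linearD; apply: cn_proj_eq => i m mc.
rewrite -(fE i m mc) path_coefD path_coefZ coef_qpath !coef_qpathM ffunE eqxx.
rewrite coef_drop_poly subn0; case: eqP => _ /=; last by rewrite mulr0 addr0.
case: m mc => [|m] mc /=; first by rewrite mulr1 addr0.
by rewrite mulr0 add0r subn1 addn1.
Qed.

Lemma low_coef k x f : low k x -> cn_proj A f = x ->
  forall i m, (m < clen i)%N -> (m < k)%N -> (f i)`_m = 0.
Proof. by move=> [g <- gk] /cn_proj_eqP fg i m mc mk; rewrite fg // gk. Qed.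

Lemma lowW k l x : (l <= k)%N -> low k x -> low l x.
Proof. by move=> lk [f <- fk]; exists f => // i m ml; apply: fk; apply: leq_trans lk. Qed.

Lemma lowMr k y u : low k (y * npath u k).
Proof. by have := lowM (low0 y) (low_npath u k). Qed.

Lemma low_scale_npath c u l k : (l < clen u)%N -> (l < k)%N -> low k (c *: npath u l) -> c = 0.
Proof.
rewrite /npath -linearZ => lc lk /low_coef/(_ erefl u l lc lk).
by rewrite path_coefZ coef_qpath !eqxx mulr1.
Qed.

End NakayamaPaths.

(** * Resolutions by modules generated by idempotents *)

Section IdempotentModules.
Variables (F : fieldType) (A : algType F).

Record idempot := Idempot { ival : A; ivalP : ival * ival = ival }.
Implicit Types e : idempot.

Fact idem_mod_closed e : submod_closed [pred x : (A^c)^o | ival e * (x : A) == x].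
Proof.
split=> [|a x y]; rewrite !inE; first by rewrite mulr0.
move=> /eqP ex /eqP ey; apply/eqP.
have -> : a *: x + y = (x : A) * (a : A) + (y : A) by [].
by rewrite mulrDr mulrA ex ey.
Qed.

(** The right ideal [e A]: scalars from [A^c] act by right multiplication, which commutes with left
    multiplication by [e]. *)
Definition idem_mod e : rmodType A := submod_type (Submod (idem_mod_closed e)).

Definition mod_val e (x : idem_mod e) : A := submod_val x.

Lemma mod_valP e (x : idem_mod e) : ival e * mod_val x = mod_val x.
Proof. by case: x => x /= xe; apply/eqP; move: xe; rewrite inE. Qed.

Lemma mod_val_inj e : injective (@mod_val e).
Proof. exact: val_inj. Qed.

Lemma mod_valZ e (a : A^c) (x : idem_mod e) : mod_val (a *: x) = mod_val x * (a : A).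
Proof. by []. Qed.

Fact idem_elt_mem e (x : A) :
  (ival e * x : A) \in submod_mem (Submod (idem_mod_closed e)).
Proof. by rewrite !inE mulrA ivalP. Qed.

Definition idem_elt e (x : A) : idem_mod e := SubmodType (idem_elt_mem e x).

Lemma idem_eltE e x : mod_val (idem_elt e x) = ival e * x.
Proof. by []. Qed.

Definition idem_gen e : idem_mod e := idem_elt e 1.

Lemma idem_genE e : mod_val (idem_gen e) = ival e.
Proof. by rewrite idem_eltE mulr1. Qed.

Section Evaluation.
Variables (N : rmodType A) (e : idempot) (m : N).
Definition idem_ev (x : idem_mod e) : N := (mod_val x : A^c) *: m.
Fact idem_ev_is_linear : linear idem_ev.
Proof.
move=> a x y; rewrite /idem_ev scalerA -scalerDl; congr (_ *: _).
Qed.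
HB.instance Definition _ :=
  GRing.isLinear.Build A^c (idem_mod e) N *:%R idem_ev idem_ev_is_linear.
End Evaluation.

(** Since [x = e x], a homomorphism from [e A] is determined by the image of [e]; with target [A] it
    is a left multiplication. *)
Lemma idem_mod_hom (N : rmodType A) e (f : {linear idem_mod e -> N}) x :
  f x = (mod_val x : A^c) *: f (idem_gen e).
Proof.
rewrite -linearZ; congr (f _); apply: mod_val_inj.
by rewrite mod_valZ idem_genE mod_valP.
Qed.

Lemma idem_mod_proj e : projective (idem_mod e).
Proof.
move=> M N g f gsurj; have [m gm] := gsurj (f (idem_gen e)).
by exists (idem_ev (e := e) m) => x; rewrite [RHS]idem_mod_hom /= /idem_ev linearZ gm.
Qed.

Lemma idem_mod_hom_ring e (f : {linear idem_mod e -> (A^c)^o}) x :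
  f x = (f (idem_gen e) : A) * mod_val x :> A.
Proof. by rewrite idem_mod_hom. Qed.

Lemma idem_mod_hom_gen e (f : {linear idem_mod e -> (A^c)^o}) :
  (f (idem_gen e) : A) * ival e = f (idem_gen e).
Proof. by rewrite -[ival e]idem_genE -idem_mod_hom_ring. Qed.

Lemma mod_val_hom e e' (f : {linear idem_mod e -> idem_mod e'}) x :
  mod_val (f x) = mod_val (f (idem_gen e)) * mod_val x.
Proof. by rewrite idem_mod_hom. Qed.

Lemma fscale_regular (c : F) (x : A) : fscale c (x : (A^c)^o) = c *: x :> A.
Proof. by rewrite -[RHS]mulr_algr. Qed.

Section Resolution.
Variables (S : rmodType A) (s : S) (e : nat -> idempot) (a : nat -> A).
Hypothesis ea : forall k, ival (e k) * a k = a k.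
Hypothesis ae : forall k, a k * ival (e k.+1) = a k.
Hypothesis s_surj : forall y, exists2 x : A, ival (e 0%N) * x = x & (x : A^c) *: s = y.
Hypothesis s_exact : forall x, ival (e 0%N) * x = x ->
  ((x : A^c) *: s = 0 <-> exists2 y, ival (e 1%N) * y = y & a 0%N * y = x).
Hypothesis a_exact : forall k x, ival (e k.+1) * x = x ->
  (a k * x = 0 <-> exists2 y, ival (e k.+2) * y = y & a k.+1 * y = x).

Definition idem_diff k : {linear idem_mod (e k.+1) -> idem_mod (e k)} :=
  idem_ev (idem_elt (e k) (a k)).

Lemma mod_val_idem_diff k x : mod_val (idem_diff k x) = a k * mod_val x.
Proof. by rewrite -[LHS]/(ival (e k) * a k * mod_val x) ea. Qed.

Lemma idem_elt_surj k x : ival (e k) * x = x -> exists y : idem_mod (e k), mod_val y = x.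
Proof. by exists (idem_elt (e k) x); rewrite idem_eltE. Qed.

Fact idem_res_surj : surjective (idem_ev (e := e 0%N) s).
Proof. by move=> y; have [x /idem_elt_surj[z <-] <-] := s_surj y; exists z. Qed.

Fact idem_res_exact0 x : idem_ev s x = 0 <-> exists y, idem_diff 0 y = x.
Proof.
rewrite /idem_ev s_exact ?mod_valP //; split=> [[_ /idem_elt_surj[y <-] ayx]|[y <-]].
  by exists y; apply: mod_val_inj; rewrite mod_val_idem_diff.
by exists (mod_val y); rewrite ?mod_valP ?mod_val_idem_diff.
Qed.

Fact idem_res_exactS k x : idem_diff k x = 0 <-> exists y, idem_diff k.+1 y = x.
Proof.
have -> : idem_diff k x = 0 <-> a k * mod_val x = 0.
  split=> [/(congr1 (@mod_val _))|ax]; first by rewrite mod_val_idem_diff.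
  by apply: mod_val_inj; rewrite mod_val_idem_diff ax.
rewrite a_exact ?mod_valP //; split=> [[_ /idem_elt_surj[y <-] ayx]|[y <-]].
  by exists y; apply: mod_val_inj; rewrite mod_val_idem_diff.
by exists (mod_val y); rewrite ?mod_valP ?mod_val_idem_diff.
Qed.

Definition idem_res : proj_resolution S :=
  @ProjResolution A^c S (fun k => idem_mod (e k)) idem_diff (idem_ev s)
    (fun k => @idem_mod_proj (e k)) idem_res_surj idem_res_exact0 idem_res_exactS.

(** Identifying [Hom(e A, A)] with [A e] turns precomposition with the differential into right
    multiplication by [a k]. *)
Lemma idem_res_cocycle k (f : {linear idem_res k -> (A^c)^o}) :
  cocycle f <-> (f (idem_gen (e k)) : A) * a k = 0.
Proof.
split=> [/(_ (idem_gen (e k.+1)))|fa x].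
  by rewrite idem_mod_hom_ring mod_val_idem_diff idem_genE ae.
by rewrite [LHS]idem_mod_hom_ring mod_val_idem_diff mulrA fa mul0r.
Qed.

(** The multiplier [b] may lie outside [A e_(k+1)], which allows choices such as [c *: 1]; the
    factor [ival (e k.+1)] normalises it. *)
Lemma idem_res_coboundary k (f : idem_res k.+1 -> (A^c)^o) (b : A) :
  (forall x : idem_mod (e k.+1), f x = b * mod_val x) ->
  coboundary f <-> exists y : A, b * ival (e k.+1) = y * a k.
Proof.
move=> fb; split=> [[g gE]|[y yE]].
  exists (g (idem_gen (e k))); rewrite -(idem_genE (e k.+1)) -fb gE.
  by rewrite [LHS]idem_mod_hom_ring mod_val_idem_diff idem_genE ae.
exists (idem_ev (e := e k) (y : (A^c)^o)) => x.
rewrite fb -(mod_valP x) mulrA yE /= /idem_ev.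
have -> : mod_val (idem_diff k x) = a k * mod_val x := mod_val_idem_diff x.
by rewrite -mulrA.
Qed.

Lemma pd_le_idem_res k : (forall j, (k < j)%N -> ival (e j) = 0) -> pd_le S k.
Proof.
by move=> e0; exists idem_res => j /e0 ej x; apply: mod_val_inj; rewrite -mod_valP ej mul0r.
Qed.

(** The projection of [pd_le_split] sends [e_k] to some [a k * y] and fixes [a k], the image of
    [e_(k+1)] under the differential. *)
Lemma pd_le_idem_res_split k : pd_le S k -> exists y, a k * y * a k = a k.
Proof.
move=> /(@pd_le_split _ _ _ idem_res)[g [gim gd]].
have [y gy] := gim (idem_gen (e k)); exists (mod_val y).
rewrite -[in LHS]mod_val_idem_diff -[idem_diff k y]gy.
have := congr1 (@mod_val _) (gd (idem_gen (e k.+1))).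
by rewrite [in LHS]mod_val_hom [in LHS]mod_val_idem_diff [in RHS]mod_val_idem_diff idem_genE ae.
Qed.

Lemma ext_dim0_idem_res : ext_dim S (A^c)^o 0 0 <->
  forall b : A, b * ival (e 0%N) = b -> b * a 0%N = 0 -> b = 0.
Proof.
split=> [S0 b be ba|b0].
  pose f : {linear idem_res 0%N -> (A^c)^o} := idem_ev (e := e 0%N) (b : (A^c)^o).
  have fb : f (idem_gen (e 0%N)) = b.
    by rewrite /f /= /idem_ev idem_genE -[LHS]/(b * ival (e 0%N)).
  have /(ext_dim00 S0) f0 : cocycle f by apply/idem_res_cocycle; rewrite fb.
  by rewrite -fb f0.
exists idem_res, (fun=> idem_ev (e := e 0%N) (0 : (A^c)^o)); split=> [[] //|f|c _ [] //].
move=> /idem_res_cocycle/(b0 _ (idem_mod_hom_gen _)) f0; exists (fun=> 0) => x.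
by rewrite big_ord0 subr0 [LHS]idem_mod_hom_ring f0 mul0r.
Qed.

Lemma ext_dim0S_idem_res k :
  (forall b : A, b * ival (e k.+1) = b -> b * a k.+1 = 0 -> exists y, b = y * a k) ->
  ext_dim S (A^c)^o k.+1 0.
Proof.
move=> b0; exists idem_res, (fun=> idem_ev (e := e k.+1) (0 : (A^c)^o)).
split=> [[] //|f|c _ [] //].
move=> /idem_res_cocycle/(b0 _ (idem_mod_hom_gen _))[y fy]; exists (fun=> 0).
apply/(idem_res_coboundary (b := f (idem_gen (e k.+1)))) => [x|].
  by rewrite big_ord0 subr0 idem_mod_hom_ring.
by exists y; rewrite idem_mod_hom_gen.
Qed.

(** As [a k.+1 = 0], every map in degree [k.+1] is a cocycle. The two other conditions say that the
    idempotent is a basis of [A e_(k+1)] modulo [A a_k]; its class is that of the inclusion [z]. *)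
Lemma ext_dim1_idem_res k : a k.+1 = 0 ->
  (forall b : A, b * ival (e k.+1) = b -> exists (c : F) y, b = c *: ival (e k.+1) + y * a k) ->
  (forall (c : F) y, c *: ival (e k.+1) = y * a k -> c = 0) ->
  ext_dim S (A^c)^o k.+1 1.
Proof.
move=> ak1 span free; pose z : {linear idem_mod (e k.+1) -> (A^c)^o} := idem_ev (1 : (A^c)^o).
have zE x : z x = mod_val x :> A by rewrite -[LHS]/(1 * mod_val x) mul1r.
exists idem_res, (fun=> z); split=> [_|f _|c].
- by move=> x; rewrite [LHS]zE mod_val_idem_diff ak1 mul0r.
- have [c [y fE]] := span _ (idem_mod_hom_gen f); exists (fun=> c).
  apply/(idem_res_coboundary (b := f (idem_gen (e k.+1)) - c *: 1)) => [x|].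
    rewrite big_ord1 [fscale _ _]fscale_regular zE idem_mod_hom_ring.
    by rewrite [RHS]mulrBl -scalerAl mul1r.
  by exists y; rewrite mulrBl idem_mod_hom_gen fE -scalerAl mul1r addrC addKr.
- move=> cob i; rewrite (ord1 i).
  have /(idem_res_coboundary (b := c ord0 *: 1)) :
      forall x : idem_mod (e k.+1), \sum_i fscale (c i) (z x) = (c ord0 *: 1) * mod_val x.
    by move=> x; rewrite big_ord1 [fscale _ _]fscale_regular zE -scalerAl mul1r.
  by move=> [/(_ cob)[y]]; rewrite -scalerAl mul1r => /free.
Qed.

Lemma ext_dim1_span k : ext_dim S (A^c)^o k.+1 1 -> a k.+1 = 0 ->
  exists z : A, forall b : A, b * ival (e k.+1) = b -> exists (c : F) y, b = c *: z + y * a k.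
Proof.
move=> /(@ext_dim_span _ _ _ _ idem_res)[z zspan] ak1.
exists (z ord0 (idem_gen (e k.+1))) => b be.
have [|c] := zspan (idem_ev (e := e k.+1) (b : (A^c)^o)).
  by apply/idem_res_cocycle; rewrite ak1 mulr0.
pose w : A := z ord0 (idem_gen (e k.+1)).
move=> /(idem_res_coboundary (b := b - c ord0 *: w))[x|y].
  rewrite big_ord1 [fscale _ _]fscale_regular [z _ _]idem_mod_hom_ring.
  by rewrite [RHS]mulrBl -scalerAl.
rewrite mulrBl be -scalerAl idem_mod_hom_gen => bE.
by exists (c ord0), y; rewrite -bE addrC subrK.
Qed.

End Resolution.
End IdempotentModules.

(** * The minimal resolution of a simple module *)

Section SimpleResolution.
Variables (F : fieldType) (n : nat) (A : CNakayama F n).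
Implicit Types (u v : 'I_n.+1) (x y : A) (p : option ('I_n.+1 * nat)).

Fact npath0_idem u : npath A u 0 * npath A u 0 = npath A u 0.
Proof. by rewrite npathM eqxx. Qed.
Definition videm u : idempot A := Idempot (npath0_idem u).

Fact zero_idem : 0 * 0 = 0 :> A.
Proof. by rewrite mulr0. Qed.

(* The differentials of the minimal resolution of a simple module are left
   multiplications by paths; [Some (u, l)] stands for the path of length l from
   u, and [None] for the zero map from the zero module. *)
Definition step_path p : A := if p is Some (u, l) then npath A u l else 0.
Definition step_source p : idempot A :=
  if p is Some (u, l) then videm (path_end l u) else Idempot zero_idem.
(** By [npath_kernel], the path of length [clen A u - l] from the end of [(u, l)] generates the
    kernel; if it vanishes, the resolution stops. *)
Definition next_step p : option ('I_n.+1 * nat) :=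
  if p is Some (u, l) then
    let l' := (clen A u - l)%N in
    if npath A (path_end l u) l' == 0 then None else Some (path_end l u, l')
  else None.

Variable i : 'I_n.+1.

(** The initial arrow generates the radical of [e_i A], the first syzygy of the simple module. *)
Definition res_step k := iter k next_step (Some (i, 1%N)).
Definition res_idem k : idempot A :=
  if k is k'.+1 then step_source (res_step k') else videm i.
Definition res_path k : A := step_path (res_step k).

(** The upper bound keeps the path nonzero, the lower bound keeps it in the radical, so that the
    resolution is minimal. *)
Lemma res_stepP k u l : res_step k = Some (u, l) -> (0 < l < clen A u)%N.
Proof.
elim: k u l => [|k IHk] u l /=; first by move=> [<- <-]; apply: clen_ge2.
case E: (res_step k) => [[v m]|//] /=; have := IHk _ _ E.
by case: ifP => // + ? [<- <-]; rewrite npath_eq0; lia.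
Qed.

Lemma res_idem_pathl k : ival (res_idem k) * res_path k = res_path k.
Proof.
case: k => [|k]; rewrite /res_path /=; first by rewrite -/(path_end 0 i) npathMend.
case: (res_step k) => [[u l]|] /=; last by rewrite mulr0.
by case: ifP => _ /=; rewrite ?mulr0 // npathM eqxx.
Qed.

Lemma res_idem_pathr k : res_path k * ival (res_idem k.+1) = res_path k.
Proof.
rewrite /res_path /=; case: (res_step k) => [[u l]|] /=; last by rewrite mulr0.
by rewrite npathMend addn0.
Qed.

Lemma res_exact k x : ival (res_idem k.+1) * x = x ->
  (res_path k * x = 0 <-> exists2 y, ival (res_idem k.+2) * y = y & res_path k.+1 * y = x).
Proof.
rewrite /res_path /= -/(res_step k); case E: (res_step k) => [[u l]|] /=; last first.
  by rewrite mul0r => <-; split=> // _; exists 0; rewrite mulr0.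
have /andP[l0 lc] := res_stepP E; move=> ex; split=> [px|[y ey <-]]; last first.
  case: ifP ey => [_ _|_ _] /=; first by rewrite mul0r mulr0.
  rewrite mulrA npathMend subnKC ?(ltnW lc) //.
  by rewrite (eqP (_ : npath A u (clen A u) == 0)) ?mul0r // npath_eq0.
have [y ey yx] := npath_kernel (ltnW lc) ex px.
case: ifP yx => [/eqP -> |_ yx] /=; first by rewrite mul0r => <-; exists 0; rewrite ?mulr0 ?mul0r.
by exists y => //; rewrite path_endD subnKC // ltnW.
Qed.

Lemma res_step_none k j : res_step k = None -> (k <= j)%N -> res_step j = None.
Proof.
by move=> kN /subnK <-; rewrite /res_step iterD -/(res_step k) kN; elim: (j - k)%N => //= m ->.
Qed.

Lemma res_step1 : res_step 1 = None <-> (clen A (ordS i) <= (clen A i).-1)%N.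
Proof. by rewrite /= npath_eq0 subn1; case: ifP. Qed.

Lemma res_step2 : (clen A i = 2)%N -> res_step 1 = Some (ordS i, 1%N).
Proof.
by move=> ci; rewrite /= ci subSS subn0 npath_eq0; have := clen_ge2 A (ordS i); case: ltnP.
Qed.

Variable S : rmodType A.
Hypothesis S_simple : simple_module S.
Variable s : S.
Hypothesis s_neq0 : s != 0.
Hypothesis s_fixed : (npath A i 0 : A^c) *: s = s.

Lemma simple_generated (t : S) : t != 0 -> forall y : S, exists x : A, (x : A^c) *: t = y.
Proof.
move=> t0 y; have [_ /(_ (fun y : S => exists x : A, (x : A^c) *: t = y))] := S_simple.
case=> [|a _ _ [x <-] [z <-]|t_0|//].
- by exists 0; rewrite scale0r.
- by exists ((a * (x : A^c) + z : A^c) : A); rewrite scalerDl scalerA.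
- by case/eqP: t0; apply: t_0; exists 1; rewrite scale1r.
Qed.

(** If the arrow moved [s] to a nonzero element, that element would generate [S], and [s] would be
    fixed by an element of the radical, which is nilpotent. *)
Lemma simple_arrow : (npath A i 1 : A^c) *: s = 0.
Proof.
apply/eqP; case: eqP => // /eqP/simple_generated/(_ s)[x].
rewrite scalerA; set w : A := npath A i 1 * x; rewrite -[X in X *: s]/(w : A^c) => ws.
have [|k wk] := @low1_nilpotent _ _ A w.
  by have := lowM (low_npath A i 1) (low0 x).
have : ((w ^+ k : A) : A^c) *: s = s.
  elim: k {wk} => [|k IHk]; first exact: scale1r.
  by rewrite -{2}IHk -{2}ws scalerA exprS.
by rewrite wk scale0r => s0; move: s_neq0; rewrite -s0 eqxx.
Qed.

Lemma simple_surj (y : S) : exists2 x : A, ival (res_idem 0) * x = x & (x : A^c) *: s = y.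
Proof.
have [x <-] := simple_generated s_neq0 y.
exists (npath A i 0 * x); first by rewrite /= mulrA npath0_idem.
by rewrite -[in RHS]s_fixed scalerA.
Qed.

(** Writing [x] as a multiple of the idempotent plus a multiple of the arrow, only the scalar [c]
    acts on [s]; it is zero because it would otherwise be invertible. *)
Lemma simple_exact x : ival (res_idem 0) * x = x ->
  ((x : A^c) *: s = 0 <-> exists2 y, ival (res_idem 1) * y = y & res_path 0 * y = x).
Proof.
rewrite /res_path /= => /npath_left_ideal[c [y [ey ->]]]; split; last first.
  move=> [z _ <-]; have -> : (npath A i 1 * z : A) = ((z : A^c) * (npath A i 1 : A^c)) by [].
  by rewrite -scalerA simple_arrow scaler0.
have -> : ((c *: npath A i 0 + npath A i 1 * y : A) : A^c) *: s = ((c%:A : A) : A^c) *: s.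
  rewrite scalerDl.
  have -> : (npath A i 1 * y : A) = ((y : A^c) * (npath A i 1 : A^c)) by [].
  rewrite -scalerA simple_arrow scaler0 addr0 -[in RHS]s_fixed scalerA.
  by congr (_ *: s); rewrite -mulr_algr.
move=> cs; suff -> : c = 0 by rewrite scale0r add0r; exists y.
apply/eqP; case: eqP => // /eqP c0; case/eqP: s_neq0.
rewrite -[LHS]scale1r -[RHS](scaler0 _ ((c^-1%:A : A) : A^c)) -cs scalerA.
congr (_ *: s); have -> : ((c^-1%:A : A) : A^c) * ((c%:A : A) : A^c) = (c%:A * c^-1%:A : A) by [].
by rewrite mulr_algl scalerA mulfV // scale1r.
Qed.

(** A nonzero step of finite resolution length would satisfy [p = p y p] with [p] in the radical,
    against [npath_unfixed]. *)
Lemma simple_pd_le k : pd_le S k <-> res_step k = None.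
Proof.
split=> [|kN].
  move/(pd_le_idem_res_split res_idem_pathl res_idem_pathr simple_surj simple_exact res_exact).
  rewrite /res_path; case E: (res_step k) => [[u l]|//] [y /= ypE].
  have /andP[l0 lc] := res_stepP E; have /eqP := npath_unfixed l0 ypE.
  by rewrite npath_eq0; lia.
apply: (pd_le_idem_res res_idem_pathl simple_surj simple_exact res_exact) => -[//|j] kj /=.
by rewrite (res_step_none kN).
Qed.

Lemma simple_has_pd k : has_pd S k.+1 <-> res_step k.+1 = None /\ res_step k <> None.
Proof.
split=> [[/simple_pd_le kN lk]|[kN k1]].
  by split=> // /simple_pd_le; apply: lk.
split=> [|j jk /simple_pd_le jN]; first exact/simple_pd_le.
by apply: k1; apply: res_step_none jN _.
Qed.

(** The longest nonzero path from [j] spans the socle of [e_j A], so its end is the vertex of that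
    socle. *)
Definition socle_free : Prop := forall j, path_end (clen A j).-1 j != i.

Lemma simple_ext0 : ext_dim S (A^c)^o 0 0 <-> socle_free.
Proof.
rewrite (ext_dim0_idem_res res_idem_pathl res_idem_pathr simple_surj simple_exact res_exact).
rewrite /res_path /=; split=> [b0 j|sf b]; last exact: npath_left_annihilator.
apply/eqP => ji; have := clen_ge2 A j => cj.
(* This path ends at [i] and is killed by the arrow there, so it would define a nonzero map from [S]
   to [A]. *)
have /eqP : npath A j (clen A j).-1 = 0.
  apply: b0; first by rewrite npathM ji eqxx addn0.
  by rewrite npathM ji eqxx; apply/eqP; rewrite npath_eq0; lia.
by rewrite npath_eq0; lia.
Qed.

Lemma simple_ext1 k u : res_step k = Some (u, 1%N) -> res_step k.+1 = None ->
  ext_dim S (A^c)^o k.+1 1.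
Proof.
move=> kE kN; apply: (ext_dim1_idem_res res_idem_pathl res_idem_pathr simple_surj simple_exact res_exact).
- by rewrite /res_path kN.
- by rewrite /= kE => b /npath_right_ideal[c [y ->]]; exists c, y; rewrite /res_path kE.
- move=> c y; rewrite /= kE /res_path kE /= => cE.
  apply: (@low_scale_npath _ _ A c (ordS u) 0 1) => //; first by have := clen_ge2 A (ordS u); lia.
  by rewrite cE; apply: lowMr.
Qed.

Lemma simple_1regular :
  k_regular 1 S <-> socle_free /\ (clen A (ordS i) <= (clen A i).-1)%N.
Proof.
split=> [[_ /simple_has_pd[/res_step1 ci _] /(_ 0%N isT)/simple_ext0 sf _]|[sf ci]] //.
split=> //; first by apply/simple_has_pd; split=> //; apply/res_step1.
  by case=> // _; apply/simple_ext0.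
by apply: (@simple_ext1 0 i) => //; apply/res_step1.
Qed.

(** The second differential is the path of length [clen A i - 1] from [ordS i]. If this length is at
    least 2, then Ext^2 has dimension greater than 1; if it is 1, then Ext^1 vanishes and Ext^2 is
    one-dimensional. *)
Lemma simple_2regular : k_regular 2 S <->
  [/\ socle_free, clen A i = 2%N & (clen A (ordS (ordS i)) <= (clen A (ordS i)).-1)%N].
Proof.
split=> [[_ /simple_has_pd[N2 N1] /(_ 0%N isT)/simple_ext0 sf ext2]|[sf ci ci1]].
  suff ci : clen A i = 2%N.
    split=> //; move: N2; rewrite -[res_step 2]/(next_step (res_step 1)) (res_step2 ci) /=.
    by rewrite npath_eq0 subn1; case: ifP.
  have := ext_dim1_span res_idem_pathl res_idem_pathr simple_surj simple_exact res_exact ext2.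
  rewrite /res_path N2 => /(_ erefl)[z].
  have := @res_stepP 1; case E: (res_step 1) N1 => [[u l]|//] _ /(_ _ _ erefl) lu /=.
  move: E => /=; rewrite subn1; case: ifP => // _ [uE lE] zspan.
  rewrite uE lE /= in zspan; have [l2|?] := leqP 2 l; last by lia.
  have [l' l'E] : exists l', l = l'.+1 by exists l.-1; lia.
  (* The idempotent at [w] and the last arrow of the path, which starts at [v], both lie in [A e_w]
     and are independent modulo the square of the radical. *)
  pose w := path_end l u; pose v := path_end l' u.
  have vw : ordS v = w by rewrite /w l'E.
  have [c [y cE]] := zspan (npath A w 0) (npath0_idem w).
  have [|c' [y' c'E]] := zspan (npath A v 1).
    by rewrite -/w -vw npathM eqxx addn0.
  have [f fz] := cn_surj z.
  have coefs b d (g : path_alg F n) : cn_proj A g = b -> (exists y, b = d *: z + y * npath A u l) ->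
      forall j m, (m < 2)%N -> (g j)`_m = d * (f j)`_m.
    move=> gb [x bE] j m m2; have mc : (m < clen A j)%N := leq_trans m2 (clen_ge2 A j).
    have b2 : low 2 (b - d *: z) by rewrite bE addrC addKr; apply: lowW l2 (lowMr _ _ _).
    have /(low_coef b2)/(_ j m mc m2)/eqP : cn_proj A (g - d *: f) = b - d *: z.
      by rewrite linearB linearZ /= gb fz.
    by rewrite path_coefD -scaleNr path_coefZ mulNr subr_eq0 => /eqP.
  have cw := coefs _ _ (qpath F w 0) erefl (ex_intro _ y cE).
  have cv := coefs _ _ (qpath F v 1) erefl (ex_intro _ y' c'E).
  have := cw w 0%N isT; have := cw v 1%N isT; have := cv v 1%N isT.
  rewrite !coef_qpath !eqxx andbF /= => fv /esym/eqP; rewrite mulf_eq0 => /orP[/eqP->|/eqP f0].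
    by rewrite mul0r => /eqP; rewrite oner_eq0.
  by move/eqP: fv; rewrite f0 mulr0 oner_eq0.
split=> //.
- apply/simple_has_pd; rewrite (res_step2 ci); split=> //.
  rewrite -[res_step 2]/(next_step (res_step 1)) (res_step2 ci) /=.
  by rewrite npath_eq0 subn1 ci1.
- move=> [_|[_|//]]; first exact/simple_ext0.
  apply: (ext_dim0S_idem_res res_idem_pathl res_idem_pathr simple_surj simple_exact res_exact) => b.
  rewrite /res_path (res_step2 ci) /= => /npath_right_ideal[c [y ->]].
  rewrite mulrDl -scalerAl -mulrA !npathMend => /eqP; rewrite addr_eq0 -mulNr => /eqP cE.
  (* By [cE], the multiple by [c] of the arrow at [ordS i] lies in the square of the radical. *)
  suff -> : c = 0 by rewrite scale0r add0r; exists y.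
  apply: (@low_scale_npath _ _ A c (ordS i) 1 2) => //; first exact: clen_ge2.
  by rewrite cE; apply: lowMr.
apply: (@simple_ext1 1 (ordS i)); first exact: res_step2.
rewrite -[res_step 2]/(next_step (res_step 1)) (res_step2 ci) /=.
by rewrite npath_eq0 subn1 ci1.
Qed.

End SimpleResolution.

(** * Lattice paths *)

Lemma int_up_ind (P : int -> Prop) (a b : int) : a <= b -> P a ->
  (forall t, a <= t < b -> P t -> P (t + 1)) -> P b.
Proof.
move=> ab Pa PS; have [k bE] : exists k : nat, b = a + k%:Z by exists `|b - a|%N; lia.
have Pk m : (m <= k)%N -> P (a + m%:Z).
  elim: m => [|m IHm] mk; first by rewrite addr0.
  by rewrite (_ : a + m.+1%:Z = a + m%:Z + 1); [apply: PS (IHm _)|]; lia.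
by rewrite bE; apply: Pk.
Qed.

Lemma int_bi_ind (P : int -> Prop) (a : int) : P a ->
  (forall t, P t <-> P (t + 1)) -> forall b, P b.
Proof.
move=> Pa PS b; have [ab|/ltW ba] := lerP a b.
  by apply: int_up_ind ab Pa _ => t _ /PS.
have: P b <-> P a; last by move=> ->.
apply: (int_up_ind (P := fun t => P b <-> P t) ba) => // t _ ->; exact: PS.
Qed.

Lemma int_homo_ltD (u : int -> int) (s t : int) :
  {homo u : s t / s < t} -> s <= t -> t - s <= u t - u s.
Proof.
move=> uS st; apply: (int_up_ind (P := fun t => t - s <= u t - u s) st); first lia.
by move=> k _; have : u k < u (k + 1) by [apply: uS; lia]; lia.
Qed.

Lemma int_homo_leP (u : int -> int) :
  (forall t, u t <= u (t + 1)) -> {homo u : s t / s <= t}.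
Proof.
move=> uS s t st; apply: (int_up_ind (P := fun t => u s <= u t) st) => // k _ sk.
exact: le_trans sk (uS k).
Qed.

(** A discrete intermediate value argument, by induction on [b]. *)
Lemma int_crossing (u : int -> int) (a b y : int) : a <= b -> u a < y -> y <= u b ->
  exists t, [/\ a <= t, t < b, u t < y & y <= u (t + 1)].
Proof.
move=> ab ua; apply: (int_up_ind (P := fun b => y <= u b ->
  exists t, [/\ a <= t, t < b, u t < y & y <= u (t + 1)]) ab); first lia.
move=> t tab IH yt; have [/IH[s [? ? ? ?]]|?] := lerP y (u t).
  by exists s; split=> //; lia.
by exists t; split=> //; lia.
Qed.

Lemma int_floor (u : int -> int) (y : int) : {homo u : s t / s < t} ->
  exists t, (u t <= y) && (y < u (t + 1)).
Proof.
move=> uS; have [k yk] : exists k : nat, - k%:Z <= y - u 0 < k%:Z.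
  by move: (u 0) => z; exists (`|y - z|%N.+1); lia.
have ua : u (- k%:Z) < y + 1.
  by have := @int_homo_ltD u (- k%:Z) 0 uS; lia.
have ub : y + 1 <= u k%:Z by have := @int_homo_ltD u 0 k%:Z uS; lia.
have [|t [_ _ ? ?]] := int_crossing _ ua ub; first lia.
by exists t; lia.
Qed.

Section Floor.
Variables (u : int -> int) (uS : {homo u : s t / s < t}).
Implicit Types t y : int.

(** Up to an additive constant, this counts the values of [u] that are at most [y]. *)
Definition ifloor (y : int) : int := xchoose (int_floor y uS).

Lemma ifloorP y : u (ifloor y) <= y < u (ifloor y + 1).
Proof. exact: xchooseP (int_floor y uS). Qed.

Lemma ifloor_unique y t : u t <= y < u (t + 1) -> ifloor y = t.
Proof.
have := ifloorP y; set s := ifloor y.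
have := @int_homo_ltD u (s + 1) t uS; have := @int_homo_ltD u (t + 1) s uS; lia.
Qed.

Lemma ifloor_succ_in y : (exists t, u t = y + 1) -> ifloor (y + 1) = ifloor y + 1.
Proof.
case=> t ut; rewrite (@ifloor_unique y (t - 1)).
  by rewrite subrK; apply: ifloor_unique; have : u t < u (t + 1) by [apply: uS; lia]; lia.
by have : u (t - 1) < u t by [apply: uS; lia]; rewrite subrK; lia.
Qed.

Lemma ifloor_succ_notin y : ~ (exists t, u t = y + 1) -> ifloor (y + 1) = ifloor y.
Proof.
move=> nu; apply: ifloor_unique; have := ifloorP y.
have : u (ifloor y + 1) <> y + 1 by move=> ut; apply: nu; exists (ifloor y + 1).
lia.
Qed.

End Floor.

Section LatticePathFacts.
Variable L : lattice_path.
Implicit Types i s t x y : int.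

Lemma lp_fst_homo : {homo (fun t => (L t).1) : s t / s <= t}.
Proof. by apply: int_homo_leP => t; case: (lp_step L t) => -> /=; lia. Qed.

Lemma lp_snd_homo : {homo (fun t => (L t).2) : s t / s <= t}.
Proof. by apply: int_homo_leP => t; case: (lp_step L t) => -> /=; lia. Qed.

(** Each step raises the coordinate sum by one, so this sum measures time along the path. *)
Lemma lp_sumB s t : (L t).1 + (L t).2 - ((L s).1 + (L s).2) = t - s.
Proof.
apply: (int_bi_ind (P := fun t => (L t).1 + (L t).2 - ((L s).1 + (L s).2) = t - s)
  (a := s)); first lia.
by move=> k; case: (lp_step L k) => -> /=; lia.
Qed.

Lemma containsP (w : seq (int * int)) : contains L w <->
  exists t, all (fun m => L (t + m%:Z) == nth (0, 0) w m) (iota 0 (size w)).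
Proof.
split=> -[t Lt]; exists t.
  by apply/allP => m; rewrite mem_iota => /Lt ->.
by move=> m mw; apply/eqP; apply: (allP Lt); rewrite mem_iota.
Qed.

Lemma contains2 a b : contains L [:: a; b] <-> exists t, L t = a /\ L (t + 1) = b.
Proof.
rewrite containsP; split=> -[t Lt]; exists t; move: Lt; rewrite /= addr0 andbT.
  by move=> /andP[/eqP ? /eqP ?].
by move=> [-> ->]; rewrite !eqxx.
Qed.

Lemma contains3 a b c : contains L [:: a; b; c] <->
  exists t, [/\ L t = a, L (t + 1) = b & L (t + 1 + 1) = c].
Proof.
rewrite containsP; split=> -[t Lt]; exists t; move: Lt;
  rewrite /= addr0 andbT (_ : t + 2%:Z = t + 1 + 1); try lia.
  by move=> /and3P[/eqP ? /eqP ? /eqP ?].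
by move=> [-> -> ->]; rewrite !eqxx.
Qed.

Lemma vstepP x y : vstep L x y <-> exists t, L t = (x, y) /\ L (t + 1) = (x + 1, y).
Proof. exact: contains2. Qed.

Lemma hstepP x y : hstep L x y <-> exists t, L t = (x, y) /\ L (t + 1) = (x, y + 1).
Proof. exact: contains2. Qed.

Lemma valleyP x y : valley L x y <->
  exists t, [/\ L t = (x - 1, y), L (t + 1) = (x, y) & L (t + 1 + 1) = (x, y + 1)].
Proof. exact: contains3. Qed.

Lemma double_riseP x y : double_rise L x y <->
  exists t, [/\ L t = (x, y - 1), L (t + 1) = (x, y) & L (t + 1 + 1) = (x, y + 1)].
Proof. exact: contains3. Qed.

Lemma double_fallP x y : double_fall L x y <->
  exists t, [/\ L t = (x - 1, y), L (t + 1) = (x, y) & L (t + 1 + 1) = (x + 1, y)].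
Proof. exact: contains3. Qed.

Lemma lp_time_inj s t : L s = L t -> s = t.
Proof. by move=> st; have := lp_sumB s t; rewrite st; lia. Qed.

Section VerticalSteps.
Variable H : int -> int.
Hypothesis vstepE : forall x y, vstep L x y <-> y = H x.

Lemma vstep_height_homo : {homo H : s t / s <= t}.
Proof.
apply: int_homo_leP => x.
have /vstepP[t [Lt _]] : vstep L x (H x) by apply/vstepE.
have /vstepP[t' [Lt' _]] : vstep L (x + 1) (H (x + 1)) by apply/vstepE.
have [tt'|/ltW tt'] := lerP t t'; first by have := lp_snd_homo tt'; rewrite Lt Lt'.
by have := lp_fst_homo tt'; rewrite Lt Lt' /=; lia.
Qed.

Lemma double_fall_iff x : (exists y, double_fall L x y) <-> H (x - 1) = H x.
Proof.
split=> [[y /double_fallP[t [L0 L1 L2]]]|Hx].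
  have -> : H (x - 1) = y.
    by apply/esym/vstepE/vstepP; exists t; rewrite L0 L1 subrK.
  by apply/vstepE/vstepP; exists (t + 1); rewrite L1 L2.
have /vstepP[t [L0 L1]] : vstep L (x - 1) (H x) by apply/vstepE.
have /vstepP[t' [L0' L1']] : vstep L x (H x) by apply/vstepE.
exists (H x); apply/double_fallP; exists t; split=> //; first by rewrite L1 subrK.
by rewrite -L1'; congr (L (_ + 1)); apply: lp_time_inj; rewrite L1 L0' subrK.
Qed.

Lemma valley_vstep x y : valley L x y -> H (x - 1) = y /\ H (x - 1) < H x.
Proof.
move=> /valleyP[t [L0 L1 L2]].
have Hy : y = H (x - 1) by apply/vstepE/vstepP; exists t; rewrite L0 L1 subrK.
split=> //; rewrite lt_neqAle vstep_height_homo ?gerBl ?andbT //; apply/eqP => Hx.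
have /vstepP[t' [L0' L1']] : vstep L x y by apply/vstepE; rewrite Hy.
have tt' : t + 1 = t' by apply: lp_time_inj; rewrite L1 L0'.
by move: L1'; rewrite -tt' L2 => -[]; lia.
Qed.

Lemma vstep_valley x : H (x - 1) < H x -> valley L x (H (x - 1)).
Proof.
move=> Hx; have /vstepP[t [L0 L1]] : vstep L (x - 1) (H (x - 1)) by apply/vstepE.
apply/valleyP; exists t; split=> //; first by rewrite L1 subrK.
have := lp_step L (t + 1); rewrite L1 /= subrK => -[//|L2].
by move: Hx; rewrite -(vstepE x (H (x - 1))).1 ?ltxx //; apply/vstepP; exists (t + 1); rewrite L1 L2 subrK.
Qed.

Lemma double_rise_iff (B : int) y : (forall x, x + 1 <= H x <= x + B) ->
  (exists x, double_rise L x y) <-> forall x, H x <> y.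
Proof.
move=> Hb; split=> [[x /double_riseP[t [L0 L1 L2]]] k Hk|Hy].
  have /vstepP[t' [L0' L1']] : vstep L k y by apply/vstepE.
  have [t't|tt'] := lerP t' t; first by have := lp_snd_homo t't; rewrite L0 L0' /=; lia.
  have [t't|t't] := lerP (t + 1 + 1) t'.
    by have := lp_snd_homo t't; rewrite L2 L0' /=; lia.
  by move: L1'; rewrite (_ : t' = t + 1) ?L2; [case|]; lia.
(* The bounds on [H] put the height below [y] at abscissa [y - B - 1] and above [y] at abscissa [y],
   so the path crosses level [y] in between. *)
have /vstepP[t [L0 _]] : vstep L (y - B - 1) (H (y - B - 1)) by apply/vstepE.
have /vstepP[t' [L0' _]] : vstep L y (H y) by apply/vstepE.
have Lt : (L t).2 < y by rewrite L0 /=; have := Hb (y - B - 1); lia.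
have Lt' : y <= (L t').2 by rewrite L0' /=; have := Hb y; lia.
have [|s [_ _ Ls Ls']] := int_crossing (u := fun t => (L t).2) _ Lt Lt'.
  rewrite leNgt; apply/negP => /ltW/lp_snd_homo/=; lia.
exists (L s).1; apply/double_riseP; exists s.
have {}Ls : L (s + 1) = ((L s).1, y).
  by case: (lp_step L s) Ls' => -> /=; [move=> ?; congr pair|]; lia.
split=> //.
  case: (lp_step L s); rewrite Ls; last by move=> /(congr1 fst)/=; lia.
  move=> /(congr1 snd)/= yE.
  by rewrite [LHS]surjective_pairing; congr pair; lia.
case: (lp_step L (s + 1)); rewrite Ls //= => Ls2.
by case: (Hy (L s).1); apply/esym/vstepE/vstepP; exists (s + 1).
Qed.

End VerticalSteps.

(** * Steps of a lattice path with prescribed valleys *)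

Section Valleys.
Variables (r f : int -> int).
Hypotheses (rS : {homo r : s t / s < t}) (fS : {homo f : s t / s < t}).
Hypothesis valleyE : forall x y, valley L x y <-> exists t, (x, y) = (r t, f t).

Lemma valley_time t : exists s, [/\ L s = (r t - 1, f t), L (s + 1) = (r t, f t)
  & L (s + 1 + 1) = (r t, f t + 1)].
Proof. by apply/valleyP/valleyE; exists t. Qed.

(** The path comes from smaller abscissas, since valleys exist arbitrarily far back. The vertical
    step by which it enters abscissa [x] ends in the required valley. *)
Lemma hstep_valley s x y : L s = (x, y) -> L (s + 1) = (x, y + 1) ->
  exists2 t, r t = x & f t <= y.
Proof.
move=> L0 L1; have [t /andP[rt _]] := int_floor x rS.
have [a [La _ _]] := valley_time t.
have Lax : (L a).1 < x by rewrite La /=; lia.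
have Lsx : x <= (L s).1 by rewrite L0.
have [|b [_ bs Lb Lb']] := int_crossing (u := fun t => (L t).1) _ Lax Lsx.
  rewrite leNgt; apply/negP => /ltW/lp_fst_homo/=; rewrite L0 /=; lia.
have {}Lb1 : L (b + 1) = (x, (L b).2).
  by case: (lp_step L b) Lb' => -> /=; [|move=> ?; congr pair]; lia.
have Lb0 : L b = (x - 1, (L b).2).
  case: (lp_step L b); rewrite Lb1; first by move=> /(congr1 fst)/=; lia.
  by move=> /(congr1 fst)/= xE; rewrite [LHS]surjective_pairing; congr pair; lia.
have /valleyE[t' [xE yE]] : valley L x (L b).2.
  apply/valleyP; exists b; split=> //.
  case: (lp_step L (b + 1)); rewrite Lb1 //= => Lb2.
  have /lp_fst_homo : b + 1 + 1 <= s + 1 by lia.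
  by rewrite Lb2 L1 /=; lia.
exists t'; first by [].
have /lp_snd_homo : b <= s by lia.
by rewrite L0 -yE.
Qed.

(** Symmetrically, the path leaves level [y] by a horizontal step, and the vertical step just before
    it ends in the required valley. *)
Lemma vstep_valley_r s x y : L s = (x, y) -> L (s + 1) = (x + 1, y) ->
  exists2 t, f t = y & x + 1 <= r t.
Proof.
move=> L0 L1; have [t /andP[_ ft]] := int_floor y fS.
have [a [_ _ La]] := valley_time (t + 1).
have Lsy : (L (s + 1)).2 < y + 1 by rewrite L1 /=; lia.
have Lay : y + 1 <= (L (a + 1 + 1)).2 by rewrite La /=; lia.
have [|b [sb _ Lb Lb']] := int_crossing (u := fun t => (L t).2) _ Lsy Lay.
  rewrite leNgt; apply/negP => /ltW/lp_snd_homo/=; lia.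
have {}Lb0 : L b = ((L b).1, y).
  rewrite [LHS]surjective_pairing; congr pair.
  by case: (lp_step L b) Lb' => -> /=; lia.
have Lb1 : L (b + 1) = ((L b).1, y + 1).
  by case: (lp_step L b) Lb' => -> //=; rewrite Lb0 //=; lia.
have xb : x + 1 <= (L b).1 by have := lp_fst_homo sb; rewrite L1.
have /valleyE[t' [xE yE]] : valley L (L b).1 y.
  have bE : b = b - 1 + 1 by lia.
  apply/valleyP; exists (b - 1); rewrite -bE; split=> //.
  have /= y0 := congr1 snd Lb0.
  case: (lp_step L (b - 1)); rewrite -bE => Lb2.
    have /= := congr1 snd Lb2; have /lp_snd_homo/= : s <= b - 1 by lia.
    by rewrite L0 /=; lia.
  have /= := congr1 fst Lb2; have /= := congr1 snd Lb2 => y1 x1.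
  by rewrite [LHS]surjective_pairing; congr pair; lia.
by exists t'; rewrite -?yE -?xE.
Qed.

Lemma one_cut_iff i : one_cut L i <-> (exists t, r t = i) /\ (exists t, f t = i + 1).
Proof.
split=> [[[y /hstepP[s [L0 L1]]] [x /vstepP[s' [L0' L1']]]]|[[t rt] [t' ft]]].
  have [t rt _] := hstep_valley L0 L1; have [t' ft _] := vstep_valley_r L0' L1'.
  by split; [exists t | exists t'].
have [s [_ L1 L2]] := valley_time t; have [s' [L0 L1' _]] := valley_time t'.
split; first by exists (f t); apply/hstepP; exists (s + 1); rewrite -rt.
by exists (r t' - 1); apply/vstepP; exists s'; rewrite -ft subrK.
Qed.

Lemma two_hillP i : two_hill L i <-> exists t, [/\ L t = (i, i), L (t + 1) = (i, i + 1),
  L (t + 2) = (i, i + 2), L (t + 3) = (i + 1, i + 2) & L (t + 4) = (i + 2, i + 2)].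
Proof.
rewrite /two_hill containsP; split=> -[t Lt]; exists t; move: Lt; rewrite /= addr0 andbT.
  by move=> /and5P[/eqP ? /eqP ? /eqP ? /eqP ? /eqP ?].
by move=> [-> -> -> -> ->]; rewrite !eqxx.
Qed.

Lemma two_hill_iff i : two_hill L i <->
  exists t, [/\ r t = i, f (t + 1) = i + 2, f t <= i & i + 2 <= r (t + 1)].
Proof.
split=> [/two_hillP[s [L0 L1 L2 L3 L4]]|[t [rt ft fti rti]]].
  have [t rt fti] := hstep_valley L0 L1.
  have [|t' ft rti] := @vstep_valley_r (s + 3) (i + 1) (i + 2) L3.
    by rewrite -addrA L4 -addrA.
  have tt' : t < t'.
    by rewrite ltNge; apply/negP => t't; have := int_homo_ltD rS t't; lia.
  suff t'E : t' = t + 1 by exists t; rewrite -t'E; split=> //; lia.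
  apply/eqP; rewrite eq_le; apply/andP; split; last lia.
  (* An intermediate valley would lie to the right of [i] and below [i + 2], which is impossible for
     a monotone path through [(i, i + 2)]. *)
  rewrite leNgt; apply/negP => t1t'.
  have rt1 : r t < r (t + 1) by apply: rS; lia.
  have ft1 : f (t + 1) < f t' by apply: fS.
  have [a [_ La _]] := valley_time (t + 1).
  have [as2|/ltW as2] := lerP (a + 1) (s + 2).
    by have := lp_fst_homo as2; rewrite La L2 /=; lia.
  by have := lp_snd_homo as2; rewrite La L2 /=; lia.
have [a [_ La _]] := valley_time t; have [b [_ Lb _]] := valley_time (t + 1).
(* The time at which the coordinate sum is [2 * i + 2], as at the corner [(i, i + 2)] between the
   two valleys. *)
have [T TE] : exists T : int, T = a + 1 + (2 * i + 2 - (r t + f t)) by eexists.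
have LsumT s : (L s).1 + (L s).2 = 2 * i + 2 + (s - T).
  by have := lp_sumB (a + 1) s; rewrite La /= TE; lia.
have aT : a + 1 <= T - 2 by lia.
have bT : T + 2 <= b + 1 by have := LsumT (b + 1); rewrite Lb /=; lia.
have LT : L T = (i, i + 2).
  suff LT1 : (L T).1 = i.
    by rewrite [LHS]surjective_pairing; have := LsumT T; rewrite LT1 => ?; congr pair; lia.
  apply/eqP; rewrite eq_le; apply/andP; split; last first.
    have /lp_fst_homo : a + 1 <= T by lia.
    by rewrite La rt.
  (* Leaving abscissa [i] too early means a vertical step below level [i + 2]. The valley ending
     that level would have index greater than [t] but ordinate less than [f (t + 1)]. *)
  rewrite leNgt; apply/negP => LT1.
  have Lai : (L (a + 1)).1 < i + 1 by rewrite La /=; lia.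
  have LTi : i + 1 <= (L T).1 by lia.
  have [|s [sa sT Ls Ls']] := int_crossing (u := fun t => (L t).1) _ Lai LTi; first lia.
  have Lsi : (L s).1 = i by have := lp_fst_homo sa; rewrite La /=; lia.
  have [Ls1|Ls1] := lp_step L s; first by move: Ls'; rewrite Ls1 /=; lia.
  have [t' ft' rt'] := vstep_valley_r (surjective_pairing (L s)) Ls1.
  have tt' : t < t'.
    by rewrite ltNge; apply/negP => t't; have := int_homo_ltD rS t't; lia.
  have : f (t + 1) <= f t' by have := @int_homo_ltD f (t + 1) t' fS; lia.
  by have := LsumT T; have /lp_snd_homo : s <= T by [lia]; move=> /=; lia.
have before s : a + 1 <= s <= T -> L s = (i, i + 2 + (s - T)).
  move=> /andP[/lp_fst_homo + /lp_fst_homo]; rewrite La LT /= => ? ?.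
  by rewrite [LHS]surjective_pairing; have := LsumT s => ?; congr pair; lia.
have after s : T <= s <= b + 1 -> L s = (i + (s - T), i + 2).
  move=> /andP[/lp_snd_homo + /lp_snd_homo]; rewrite Lb LT /= => ? ?.
  by rewrite [LHS]surjective_pairing; have := LsumT s => ?; congr pair; lia.
apply/two_hillP; exists (T - 2).
by split; [rewrite before|rewrite before|rewrite before|rewrite after|rewrite after];
  try congr pair; lia.
Qed.

End Valleys.
End LatticePathFacts.

(** * Comparing the enumerations of double rises and double falls *)

Section Heights.
Variables (H r f : int -> int).
Implicit Types i j p t x y : int.
Hypothesis H_homo : {homo H : s t / s <= t}.
Hypothesis H_gt : forall x, x + 1 <= H x.
Hypotheses (rS : {homo r : s t / s < t}) (fS : {homo f : s t / s < t}).
Hypothesis rE : forall y, (forall x, H x <> y) <-> exists t, r t = y.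
Hypothesis fE : forall x, H (x - 1) = H x <-> exists t, f t = x.

(* Up to an additive constant, [count_levels y] is the number of levels at most
   y carrying a vertical step, and [count_valleys x] the number of valleys with
   abscissa at most x. *)
Definition count_levels (y : int) : int := y - ifloor rS y.
Definition count_valleys (x : int) : int := x - ifloor fS x.

Lemma count_levels_rise y : (exists t, r t = y + 1) ->
  count_levels (y + 1) = count_levels y.
Proof. by move=> ry; rewrite /count_levels ifloor_succ_in //; lia. Qed.

Lemma count_levels_vstep y x : H x = y + 1 -> count_levels (y + 1) = count_levels y + 1.
Proof.
move=> Hx; rewrite /count_levels ifloor_succ_notin; first lia.
by move/rE/(_ x).
Qed.

Lemma count_levels_homo : {homo count_levels : y z / y <= z}.
Proof.
apply: int_homo_leP => y; rewrite /count_levels.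
have := @int_homo_ltD r (ifloor rS y + 1 + 1) (ifloor rS (y + 1)) rS.
have := ifloorP rS y; have := ifloorP rS (y + 1).
have : r (ifloor rS y + 1) < r (ifloor rS y + 1 + 1) by apply: rS; lia.
lia.
Qed.

(** By monotonicity of [H], the levels strictly between the two heights carry no vertical step, so
    only the level [H x] adds to the count. *)
Lemma count_levels_next x : H (x - 1) < H x ->
  count_levels (H x) = count_levels (H (x - 1)) + 1.
Proof.
move=> Hx; have -> : H x = H x - 1 + 1 by lia.
rewrite (@count_levels_vstep _ x); last by lia.
congr (_ + 1); have Hx' : H (x - 1) <= H x - 1 by lia.
apply: (int_up_ind (P := fun y => count_levels y = count_levels (H (x - 1))) Hx') => //.
move=> y yH <-; apply: count_levels_rise; apply/rE => k Hk.
have [kx|xk] := lerP k (x - 1); first by have := H_homo kx; lia.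
have : H x <= H k by apply: H_homo; lia.
lia.
Qed.

(** From [y] to [y + 1], both counts are unchanged at a double fall, and both grow by one at a
    valley. *)
Lemma count_levels_H : forall x y, count_levels (H x) - count_valleys x =
  count_levels (H y) - count_valleys y.
Proof.
move=> x; apply: (int_bi_ind (P := fun y => count_levels (H x) - count_valleys x =
  count_levels (H y) - count_valleys y) (a := x)) => // y.
suff -> : count_levels (H (y + 1)) - count_valleys (y + 1) =
  count_levels (H y) - count_valleys y by [].
rewrite /count_valleys; have yE : y = y + 1 - 1 by lia.
have [Hy|Hy] := eqVneq (H y) (H (y + 1)).
  by rewrite -Hy ifloor_succ_in; [lia | apply/fE; rewrite -yE].
rewrite ifloor_succ_notin; last by move/fE; rewrite -yE; apply/eqP.
rewrite count_levels_next -yE; first lia.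
by rewrite lt_neqAle Hy H_homo //; lia.
Qed.

(** Both floors vanish at [p], so both counts equal [p] there, and [H p] is the next level after
    [p = H (p - 1)]. *)
Lemma normalized_return p : H (p - 1) = p -> r 0 <= p < r 1 -> f 0 <= p < f 1 ->
  forall x, count_levels (H x) = count_valleys x + 1.
Proof.
move=> Hp rp fp x; have Hp' : H (p - 1) < H p by have := H_gt p; lia.
have := count_levels_H x p; rewrite (count_levels_next Hp') Hp.
rewrite /count_levels /count_valleys.
by rewrite (@ifloor_unique r rS p 0) // (@ifloor_unique f fS p 0) //; lia.
Qed.

(** Both floors are 1 at [j + 1], so both counts equal [j] there. Level [j + 1] is a double rise, so
    [j] has the same level count, and [H (j + 1) = H x] is the next level after [j]. *)
Lemma normalized_rectangle j x : H (x - 1) = j -> j < H x -> H x = H (j + 1) ->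
  r 1 = j + 1 -> f 1 = j + 1 ->
  forall x, count_levels (H x) = count_valleys x + 1.
Proof.
move=> Hx1 Hx Hj rj fj y.
have := count_levels_H y (j + 1); rewrite -Hj (@count_levels_next x) Hx1 //.
rewrite -(@count_levels_rise j); last by exists 1.
have rfl : ifloor rS (j + 1) = 1 by apply: ifloor_unique; rewrite -rj lexx rS.
have ffl : ifloor fS (j + 1) = 1 by apply: ifloor_unique; rewrite -fj lexx fS.
by rewrite /count_levels /count_valleys rfl ffl; lia.
Qed.

Hypothesis normalized : forall x, count_levels (H x) = count_valleys x + 1.

Lemma hill_heights i :
  (exists t, [/\ r t = i, f (t + 1) = i + 2, f t <= i & i + 2 <= r (t + 1)]) <->
  [/\ forall x, H x <> i, H i = i + 1 & H (i + 1) = H (i + 2)].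
Proof.
split=> [[t [rt ft fti rti]]|[ri Hi Hi2]].
  have Hi2 : H (i + 1) = H (i + 2).
    have -> : i + 1 = i + 2 - 1 by lia.
    by apply/fE; exists (t + 1).
  have nf : H i <> H (i + 1).
    have {1}-> : i = i + 1 - 1 by lia.
    move/fE => [t' ft'].
    have := @int_homo_ltD f t' t fS; have := @int_homo_ltD f (t + 1) t' fS; lia.
  split=> //; first by apply/rE; exists t.
  have Hi : H i < H (i + 1) by have := @H_homo i (i + 1); lia.
  have iE : i + 1 - 1 = i by lia.
  (* The normalisation shows that levels [H i] and [i + 1] have the same count; if [H i] were
     larger, its own vertical step would raise the count. *)
  have := normalized (i + 1); rewrite count_levels_next iE // => /addIr.
  rewrite /count_valleys (@ifloor_unique f fS (i + 1) t); last by lia.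
  rewrite -(@ifloor_unique r rS (i + 1) t); last by lia.
  rewrite -/(count_levels _) => cE; have := H_gt i; rewrite le_eqVlt => /orP[/eqP //|iH].
  have := @count_levels_vstep (H i - 1) i; rewrite subrK => /(_ erefl).
  have : count_levels (i + 1) <= count_levels (H i - 1) by apply: count_levels_homo; lia.
  lia.
have Hi1 : H i < H (i + 1) by have := H_gt (i + 1); lia.
have iE : i + 1 - 1 = i by lia.
(* Here the normalisation says that both enumerations have the same floor [t] at [i + 1], which
   aligns their indices. *)
have := normalized (i + 1); rewrite count_levels_next iE // Hi => /addIr.
rewrite /count_levels /count_valleys => /addrI/oppr_inj fl.
set t := ifloor rS (i + 1) in fl *.
have [t1 rt1] : exists t, r t = i by apply/rE.
have t1E : t1 = t.
  apply/esym/ifloor_unique; have : r t1 < r (t1 + 1) by apply: rS; lia.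
  have : r (t1 + 1) <> i + 1 by move=> rt; have /rE/(_ i) : exists t, r t = i + 1 by exists (t1 + 1).
  lia.
have rt := ifloorP rS (i + 1); rewrite -/t in rt.
have ft := ifloorP fS (i + 1); rewrite -fl in ft.
have ft1 : f t <> i + 1.
  by move=> fti; have /fE : exists t, f t = i + 1 by [exists t]; rewrite iE; lia.
have [t2 ft2] : exists t, f t = i + 2.
  by apply/fE; rewrite -Hi2; congr (H _); lia.
have t2E : t2 = t + 1.
  have := @int_homo_ltD f t2 t fS; have := @int_homo_ltD f (t + 1 + 1) t2 fS.
  have : f (t + 1) < f (t + 1 + 1) by apply: fS; lia.
  lia.
by move: rt1 ft2; rewrite t1E t2E => rt1 ft2; exists t; split=> //; clearbody t; lia.
Qed.

End Heights.

(** Any increase of [H] between [x] and [j + 1] would create a valley before the next one allowed by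
    the rectangle. *)
Lemma rectangle_heights (D : lattice_path) (H : int -> int) (x j : int) :
  (forall x y, vstep D x y <-> y = H x) -> (forall x, x + 1 <= H x) ->
  rectangle D x j -> [/\ H (x - 1) = j, j < H x & H x = H (j + 1)].
Proof.
move=> vE H_gt [/(valley_vstep vE)[Hx Hlt] [x' [xx' _ x'min] jx']].
split=> //; first by rewrite -Hx.
have xj : x <= j + 1 by have := H_gt (x - 1); lia.
apply: (int_up_ind (P := fun y => H x = H y) xj) => // y yj ->.
have [//|Hy] := eqVneq (H y) (H (y + 1)).
have yE : y + 1 - 1 = y by lia.
suff: x' <= y + 1 by lia.
apply: (x'min _ (H (y + 1 - 1))); last by lia.
by apply: (vstep_valley vE); rewrite yE lt_neqAle Hy; apply: (vstep_height_homo vE); lia.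
Qed.

(** * Regular simple modules and the path LK(D) *)

Section Heights.
Variables (F : fieldType) (n : nat) (A : CNakayama F n) (D : lattice_path).
Hypothesis hD : dyck_path_of A D.

Definition height (k : int) : int := k + (clen A (vertex_of n k))%:Z - 1.

Lemma vstep_height x y : vstep D x y <-> y = height x.
Proof.
have [[_ /(_ x)[h hx _]] area] := hD.
have heightE z : vstep D x z -> z = height x.
  by move=> /area; rewrite kupischE /height; lia.
by split=> [/heightE|->] //; rewrite -(heightE h).
Qed.

Lemma height_gt x : x + 1 <= height x.
Proof. by rewrite /height; have := clen_ge2 A (vertex_of n x); lia. Qed.

Lemma height_bounded x : x + 1 <= height x <= x + (\max_i clen A i)%N%:Z.
Proof.
rewrite height_gt /height /=.
by have := @leq_bigmax _ (clen A) (vertex_of n x); set m := bigop _ _ _; lia.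
Qed.

Lemma socle_free_heights (i : int) :
  socle_free A (vertex_of n i) <-> forall x, height x <> i.
Proof.
split=> [sf x hx|hi j].
  have /eqP[] := sf (vertex_of n x); rewrite -vertex_ofD -hx /height.
  by congr vertex_of; have := clen_ge2 A (vertex_of n x); lia.
(* Among the integers representing the vertex [j], [i - l] is the one whose height is exactly
   [i]. *)
apply/eqP => ji; pose l := (clen A j).-1; apply: (hi (i - l%:Z)).
have vj : vertex_of n (i - l%:Z) = j.
  by apply: (@path_end_inj n l); rewrite -vertex_ofD subrK -ji.
by rewrite /height vj /l; have := clen_ge2 A j; lia.
Qed.

(** By [clen_ordS], the inequality on the right can only hold as an equality. *)
Lemma height_eqS (i : int) : height i = height (i + 1) <->
  (clen A (ordS (vertex_of n i)) <= (clen A (vertex_of n i)).-1)%N.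
Proof.
rewrite /height vertex_ofS; have := clen_ordS A (vertex_of n i).
have := clen_ge2 A (vertex_of n i); lia.
Qed.

End Heights.

Lemma LK_enumerations n (D L : lattice_path) : LK n D L -> exists r f,
  [/\ enum_rises D r, enum_falls D f, has_valleys n L r f &
    (exists p, [/\ return_at D p, r 0 <= p < r 1 & f 0 <= p < f 1]) \/
    (exists x j, [/\ rectangle D x j, r 1 = j + 1 & f 1 = j + 1])].
Proof.
case=> -[_]; first by move=> [p [r [f [? [? ?] ? ? ?]]]]; exists r, f; split=> //; left; exists p.
move=> [j [r [f [[x ?] [? ?] ? ? ?]]]]; exists r, f; split=> //.
by right; exists x, j.
Qed.

Theorem theorem3p31 (F : fieldType) (n : nat) (A : CNakayama F n)
    (D : lattice_path) (hD : dyck_path_of A D) (hDPH : DP n.+1 D \/ DH n.+1 D)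
    (L : lattice_path) (hL : LK n.+1 D L)
    (i : int) (S : rmodType A) (hS : simple_at i S) :
  (k_regular 1 S <-> one_cut L i) /\ (k_regular 2 S <-> two_hill L i).
Proof.
have [S_simple [x0 x0P]] := hS; pose s := (idem A i : A^c) *: x0.
have s_fixed : (npath A (vertex_of n i) 0 : A^c) *: s = s.
  by rewrite scalerA -[X in X *: x0]/(npath A _ 0 * npath A _ 0 : A) npath0_idem.
have [r [f [[rS rE] [fS fE] [_ LE] norm]]] := LK_enumerations hL.
pose H := height A; have vE := vstep_height hD.
have {}rE y : (forall x, H x <> y) <-> exists t, r t = y.
  by rewrite -rE (double_rise_iff vE y (height_bounded A)).
have {}fE x : H (x - 1) = H x <-> exists t, f t = x.
  by rewrite -fE (double_fall_iff vE).
have H_homo := vstep_height_homo vE; have H_gt := height_gt A.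
(* Both choices of base point lead to the same normalisation; from here on the two definitions of
   LK(D) are treated together. *)
have {}norm : forall x, count_levels rS (H x) = count_valleys fS x + 1.
  case: norm => [[p [/vE pH rp fp]]|[x [j [/(rectangle_heights vE H_gt)[? ? ?] rj fj]]]].
    exact: (@normalized_return H r f H_homo H_gt rS fS rE fE p).
  exact: (@normalized_rectangle H r f H_homo rS fS rE fE j x).
split.
  rewrite (simple_1regular S_simple x0P s_fixed) (one_cut_iff rS fS LE) -rE -fE addrK.
  by rewrite -height_eqS socle_free_heights.
rewrite (simple_2regular S_simple x0P s_fixed) (two_hill_iff rS fS LE).
rewrite (hill_heights H_homo H_gt rE fE norm).
have c2 : clen A (vertex_of n i) = 2%N <-> H i = i + 1 by rewrite /H /height; lia.
have i2 : i + 2 = i + 1 + 1 by lia.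
have := height_eqS A (i + 1); rewrite vertex_ofS -i2 -/H => c1.
by split=> -[/socle_free_heights sf /c2 ci /c1 ci1].
Qed.
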